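(* There exists a finite poset $P$ such that there is no finite poset $P'$ in which every chain has at most two elements with $\mathcal{K}P'$ combinatorially equivalent to $\mathcal{K}P$.
   Context: For a finite poset $(P,\preceq)$: a lower set is $L\subseteq P$ with $y\preceq x\in L\Rightarrow y\in L$; $\partial x=\{y: y\prec x\}$; the bundle of $x$ is $\mathrm{bu}(x)=\{y:\partial y=\partial x\}$; a subset is connected if it induces a connected subgraph of the Hasse diagram; a lower set $L$ is filled if for every $x\in P$ with $\partial x\subseteq L$ we have $L\cap\mathrm{bu}(x)\ne\emptyset$; a tube is a filled connected lower set; a tubing is a set of tubes, none equal to $P$, pairwise disjoint or nested, such that the union of the tubes of every nonempty subset is filled. The poset associahedron $\mathcal{K}P$ is a convex polytope whose poset of nonempty faces (ordered by inclusion) is isomorphic to the set of tubings of $P$ ordered by reverse containment, unique up to combinatorial equivalence (isomorphism of face posets). *)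

(* Defs.v *)
From mathcomp Require Import all_boot all_order all_algebra.
From mathcomp Require Import boolp classical_sets functions reals.

Set Implicit Arguments.
Unset Strict Implicit.
Unset Printing Implicit Defensive.

Import Order.TTheory GRing.Theory Num.Theory.

Local Open Scope ring_scope.

Section Tubings.
Context {disp : Order.disp_t} {P : finPOrderType disp}.
Implicit Types (x y z : P) (L : {set P}) (T : {set {set P}}).
Local Open Scope order_scope.

Definition lower_set L : bool :=
  [forall x in L, forall y, (y <= x) ==> (y \in L)].

Definition boundary x : {set P} := [set y | y < x]%SET.

Definition bundle x : {set P} := [set y | boundary y == boundary x]%SET.

Definition covers x y : bool := (x < y) && ~~ [exists z, (x < z) && (z < y)].

Definition hasse_adj : rel P := [rel x y | covers x y || covers y x].

(* The empty set counts as connected here. This has no effect on tubings: the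
   empty set is filled only when P is empty, and then it is all of P. *)
Definition hasse_connected L : bool :=
  [forall x in L, forall y in L,
    connect [rel u v | [&& u \in L, v \in L & hasse_adj u v]] x y].

Definition filled L : bool :=
  [forall x, (boundary x \subset L) ==> (L :&: bundle x != finset.set0)].

Definition tube L : bool := [&& lower_set L, filled L & hasse_connected L].

Definition tubing T : bool :=
  [&& [forall A in T, tube A && (A != [set: P]%SET)],
      [forall A in T, forall B in T,
         [|| [disjoint A & B], A \subset B | B \subset A]]
    & [forall S : {set {set P}},
         (S \subset T) && (S != finset.set0) ==> filled (finset.cover S)]].

Definition chain (C : {set P}) : Prop := {in C &, forall x y, x >=< y}.

End Tubings.

Definition poset_iso (S T : Type) (A : set S) (leA : S -> S -> Prop)
    (B : set T) (leB : T -> T -> Prop) : Prop :=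
  exists f : S -> T, set_bij A B f /\
    forall x y, A x -> A y -> (leA x y <-> leB (f x) (f y)).

Section Polytopes.
Context {R : realType}.
Local Open Scope classical_set_scope.

Definition conv_hull d (s : seq 'rV[R]_d) : set 'rV[R]_d :=
  [set x | exists w : 'I_(size s) -> R,
     [/\ forall i, 0 <= w i, \sum_i w i = 1 & x = \sum_i w i *: s`_i]].

Definition polytope d (Q : set 'rV[R]_d) : Prop :=
  exists s : seq 'rV[R]_d, Q = conv_hull s.

(* [f = 0] is allowed, so that [Q] is a face of itself. *)
Definition face d (Q F : set 'rV[R]_d) : Prop :=
  exists (f : {scalar 'rV[R]_d}) (b : R),
    (forall x, Q x -> f x <= b) /\ F = Q `&` [set x | f x = b].

Definition nonempty_faces d (Q : set 'rV[R]_d) : set (set 'rV[R]_d) :=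
  [set F | face Q F /\ F !=set0].

Definition comb_equiv d d' (Q : set 'rV[R]_d) (Q' : set 'rV[R]_d') : Prop :=
  poset_iso (nonempty_faces Q) (fun F G => F `<=` G)
            (nonempty_faces Q') (fun F G => F `<=` G).

(* [Q] is (a realization of) the poset associahedron of [P], which is only
   defined up to combinatorial equivalence. *)
Definition poset_associahedron disp (P : finPOrderType disp)
    d (Q : set 'rV[R]_d) : Prop :=
  polytope Q /\
  poset_iso (nonempty_faces Q) (fun F G => F `<=` G)
    [set T : {set {set P}} | tubing T] (fun S T => (T \subset S)%SET).

End Polytopes.

(* Main.v *)
Require Import Defs.
From HB Require Import structures.
From mathcomp Require Import all_boot all_order all_algebra.
From mathcomp Require Import zify.

(** Let P have minimal elements 0 and 1, with 2 above 0, with 3 and 4 above 0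
    and 1, and with 5 and 6 above 0, 1 and 2.  Its tubings are the chains of its
    ten tubes: the "caps" {1} and {0,2}, nested with every other tube but not
    with each other, and eight "sides" whose inclusions form an 8-cycle.  So
    K(P) is the octagonal prism.

    Suppose that a poset P' with chains of length at most two had the same
    tubing complex.  A strict chain of k nonempty proper filled lower sets gives
    a tubing with k tubes (take the component of a new element at each step), so
    k <= 3 in P'.  In a two-level poset without such chains of length 3 there
    are at most six nonempty proper filled lower sets.  The link of a cap is an
    8-cycle, which is not a join, so either all sides lie inside the cap or none
    does; the first case gives eight filled lower sets inside the cap, where
    chains have length at most 2.  Hence both caps are minimal tubes, around
    minimal elements u and v.  If u = v, deleting one element, and if u <> v,
    identifying u with v, leaves a two-level structure whose chains have length
    at most 2 and which still distinguishes the eight sides. *)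

Set Implicit Arguments.
Unset Strict Implicit.
Unset Printing Implicit Defensive.

Import Order.TTheory GRing.Theory Num.Theory.

(** * Filled lower sets in two-level structures *)

(* [F] is a filled lower set of the structure with carrier [Y] in which the
   elements below [x] form [D x]; [Y] and [D] vary so that sub- and quotient
   structures need no poset type of their own. *)
Definition filled_lower (T : finType) (Y : {set T}) (D : T -> {set T}) (F : {set T}) : bool :=
  [&& F \subset Y, [forall x in F, D x \subset F]
    & [forall x in Y, (D x \subset F) ==> [exists y in F, D y == D x]]].

Section TwoLevel.
Variables (T : finType) (Y : {set T}) (D : T -> {set T}).
Implicit Types (x y z : T) (A F S : {set T}).

Lemma filled_lowerP F :
  reflect [/\ F \subset Y, forall x, x \in F -> D x \subset F &
              forall x, x \in Y -> D x \subset F -> exists2 y, y \in F & D y = D x]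
          (filled_lower Y D F).
Proof.
apply: (iffP and3P) => -[FY Fl Ff]; split=> //.
- by move=> x xF; apply: (implyP (forallP Fl x)).
- move=> x xY DF; have /existsP[y /andP[yF /eqP]] := implyP (implyP (forallP Ff x) xY) DF.
  by exists y.
- by apply/forallP=> x; apply/implyP=> /Fl.
- apply/forallP=> x; apply/implyP=> xY; apply/implyP=> DF.
  by have [y yF yx] := Ff x xY DF; apply/existsP; exists y; rewrite yF yx eqxx.
Qed.

Hypothesis DY : forall x, x \in Y -> D x \subset Y.
Hypothesis D2 : forall x y, x \in Y -> y \in D x -> D y = set0.

Let M := [set x in Y | D x == set0].
Let N := [set x in Y | D x != set0].
(** For [x] in [Y] the search succeeds and its result depends on [D x] alone, so a whole bundle
    shares one representative. *)
Let rep x := odflt x [pick y in Y | D y == D x].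
Let X := [set x in N | rep x != x].

Let repP x : x \in Y -> rep x \in Y /\ D (rep x) = D x.
Proof.
by rewrite /rep; case: pickP => [y /andP[yY /eqP]|/(_ x)] //=; rewrite eqxx andbT => ->.
Qed.

Let rep_eq x y : x \in Y -> D x = D y -> rep x = rep y.
Proof.
move=> xY e; rewrite /rep -e; case: pickP => [//|/(_ x)].
by rewrite xY eqxx.
Qed.

Let in_setX_rep x : (x \in X) = (x \in N) && (rep x != x).
Proof. by rewrite inE. Qed.

Let repX x : x \in Y -> rep x \notin X.
Proof.
by move=> xY; have [rY rD] := repP xY; rewrite inE (rep_eq rY rD) eqxx andbF.
Qed.

Let DM x : x \in Y -> D x \subset M.
Proof.
move=> xY; apply/subsetP=> y yD; rewrite inE (D2 xY yD) eqxx andbT.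
exact: subsetP (DY xY) y yD.
Qed.

Let NY x : x \in N -> x \in Y. Proof. by rewrite inE => /andP[]. Qed.
Let XN x : x \in X -> x \in N. Proof. by rewrite inE => /andP[]. Qed.
Let MN x : x \in M -> x \notin N. Proof. by rewrite !inE => /andP[-> ->]. Qed.

(* The elements of [X] duplicate the boundary of their representative, so they
   may be left out of a filled lower set independently of each other. *)
Let hull A := [set x in Y | if D x == set0 then x \in A
                            else (D x \subset A) && ((x \in X) ==> (x \in A))].
Let in_hull A x : (x \in hull A) = (x \in Y) && (if D x == set0 then x \in A
                            else (D x \subset A) && ((x \in X) ==> (x \in A))).
Proof. by rewrite inE. Qed.

(** An element of [X] enters a hull only once its whole boundary is present. Requiring all of [M]
    before any element of [X] guarantees this. *)
Let good A := [&& A \subset M :|: X & (A \subset M) || (M \subset A)].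

(** The minimal element [x] fills the empty boundary. A nonempty boundary inside the hull is filled
    by its representative, which is never in [X]. *)
Let hull_filled_lower A x : x \in M -> x \in A -> filled_lower Y D (hull A).
Proof.
move=> xM xA; apply/filled_lowerP; split.
- by apply/subsetP=> y; rewrite inE => /andP[].
- move=> y; rewrite inE => /andP[yY]; case: ifP => [/eqP-> _|_ /andP[DA _]].
    exact: sub0set.
  apply/subsetP=> z zD; have /subsetP/(_ z zD) := DM yY; rewrite !inE => /andP[-> ->] /=.
  exact: subsetP DA z zD.
- move=> y yY Dy; have [Dy0|Dy0] := eqVneq (D y) set0.
    by move: xM; rewrite inE => /andP[xY /eqP Dx0]; exists x; rewrite ?inE ?xY Dx0 ?eqxx.
  have [rY rD] := repP yY; exists (rep y) => //.
  rewrite inE rY rD (negPf Dy0) (negPf (repX yY)) andbT /=.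
  apply/subsetP=> z zD; move/subsetP: Dy => /(_ z zD); rewrite inE.
  by rewrite (D2 yY zD) eqxx => /andP[].
Qed.

(** The new element [e] itself separates the hulls. If it lies in [X], then [good] gives
    [M \subset A'], so its boundary is present. *)
Let hull_proper A A' : good A' -> A \proper A' -> hull A \proper hull A'.
Proof.
move=> /andP[A'MX A'M] /properP[sAA' [e eA' eA]]; apply/properP; split.
  apply/subsetP=> x; rewrite !in_hull => /andP[->] /=; case: ifP => _; first exact: (subsetP sAA').
  move=> /andP[/subset_trans-> //=] /implyP h; apply/implyP=> xX; exact: (subsetP sAA' x (h xX)).
exists e; last first.
  have /setUP[eM|eX] := subsetP A'MX e eA'.
    by move: (eM); rewrite !inE => /andP[-> ->] /=.
  by rewrite inE eX (negPf eA) andbF; move: (XN eX); rewrite !inE => /andP[-> /negPf->].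
have /setUP[eM|eX] := subsetP A'MX e eA'.
  by move: (eM); rewrite !inE => /andP[-> ->] /=.
have MA' : M \subset A'.
  case/orP: A'M => // /subsetP/(_ e eA') eM; have := MN eM; by rewrite XN.
move: (XN eX); rewrite !inE => /andP[eY /negPf->]; rewrite eY eA' implybT andbT /=.
exact: subset_trans (DM eY) MA'.
Qed.

Hypothesis no3 : forall F1 F2 F3,
  filled_lower Y D F1 -> filled_lower Y D F2 -> filled_lower Y D F3 -> F1 != set0 ->
  F1 \proper F2 -> F2 \proper F3 -> F3 \proper Y -> False.

(** Four elements would give four strictly growing hulls; the first three violate [no3], and the
    fourth shows that the third is proper in [Y]. *)
Let cardMX : #|M :|: X| <= 3.
Proof.
rewrite leqNgt; apply/negP=> card4.
have [x0 x0M] : exists x, x \in M.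
  have /card_gt0P[x /setUP[xM|xX]] : 0 < #|M :|: X| by apply: leq_trans card4.
    by exists x.
  have /NY xY := XN xX; move: (XN xX); rewrite inE => /andP[_ /set0Pn[y yD]].
  by exists y; apply: (subsetP (DM xY)).
(* Hulls of initial segments of [l] form a chain because [M] comes first. *)
pose l := enum M ++ enum X.
have ul : uniq l.
  rewrite cat_uniq !enum_uniq andbT /=; apply/hasPn=> x; rewrite !mem_enum => /XN xN.
  by apply: contraL xN => /MN.
have ml x : (x \in l) = (x \in M :|: X) by rewrite mem_cat !mem_enum in_setU.
have sl : 4 <= size l.
  by rewrite -(card_uniqP ul) (eq_card ml).
pose A k := [set x in take k l].
have goodA k : good (A k).
  apply/andP; split.
    by apply/subsetP=> x; rewrite inE -ml => /mem_take.
  rewrite /A /l take_cat; case: ifP => _; apply/orP; [left|right].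
    by apply/subsetP=> x; rewrite inE => /mem_take; rewrite mem_enum.
  by apply/subsetP=> x xM; rewrite inE mem_cat mem_enum xM.
have propA k : k < 4 -> A k \proper A k.+1.
  move=> k4; have kl : k < size l by apply: leq_trans sl.
  apply/properP; split.
    by apply/subsetP=> x; rewrite !inE (take_nth x0 kl) mem_rcons inE => ->; rewrite orbT.
  exists (nth x0 l k); rewrite !inE.
    by rewrite (take_nth x0 kl) mem_rcons inE eqxx.
  apply/negP=> /(nthP x0)[i]; rewrite size_takel 1?(ltnW kl) // => ik; rewrite nth_take // => /eqP.
  have il := ltn_trans ik kl.
  by rewrite nth_uniq // => /eqP ik'; rewrite ik' ltnn in ik.
have [x xM xA] : exists2 x, x \in M & x \in A 1.
  move: x0M; rewrite -mem_enum /A /l; case E: (enum M) => [//|x s] _.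
  exists x; first by rewrite -mem_enum E mem_head.
  by rewrite inE /= take0 mem_head.
have xA' k : 0 < k -> x \in A k.
  by move=> k0; move: xA; rewrite !inE -(@take_takel _ 1 k) // => /mem_take.
have fA k : 0 < k -> filled_lower Y D (hull (A k)) by move=> /xA'; apply: hull_filled_lower.
apply: (no3 (fA 1 _) (fA 2 _) (fA 3 _)) => //; try by apply: hull_proper => //; apply: propA.
  apply/set0Pn; exists x; move: (xM); rewrite !inE => /andP[-> ->] /=.
  by move: xA; rewrite inE.
apply: (proper_sub_trans (hull_proper (goodA 4) (propA 3 isT))).
by apply/subsetP=> y; rewrite inE => /andP[].
Qed.


(** A filled set containing [D x] must contain some element over [D x], and here [x] is the only
    candidate. *)
Let top_rep F x : filled_lower Y D F -> x \in N -> x \notin X ->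
  (forall y, y \in X -> D y != D x) -> (x \in F) = (D x \subset F).
Proof.
move=> /filled_lowerP[FY Fl Ff] xN xX hX; apply/idP/idP; first exact: Fl.
move=> /(Ff _ (NY xN))[y yF yx].
have yY := subsetP FY y yF.
have yX : y \notin X by apply/negP=> /hX; rewrite yx eqxx.
have yN : y \in N by move: xN; rewrite !inE yY yx => /andP[].
have : rep y = rep x by apply: rep_eq.
by move: yX xX; rewrite !in_setX_rep yN xN !negbK => /eqP-> /eqP-> <-.
Qed.


Let Fam := [set F | [&& filled_lower Y D F, F != set0 & F != Y]].

Let FamP F : F \in Fam -> [/\ filled_lower Y D F, F != set0 & F != Y].
Proof. by rewrite inE => /and3P[]. Qed.

(** A set of at most three elements has at most eight subsets, and the code [c] avoids both
    extremes. *)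
Let card_Fam (c : {set T} -> {set T}) : {in Fam &, injective c} ->
  (forall F, F \in Fam -> [/\ c F \subset M :|: X, c F != set0 & c F != M :|: X]) ->
  #|Fam| <= 6.
Proof.
move=> c_inj c_im; rewrite -(card_in_imset c_inj).
pose B := powerset (M :|: X) :\ set0 :\ (M :|: X).
have sB : c @: Fam \subset B.
  apply/subsetP=> _ /imsetP[F FF ->]; have [cA c0 cA'] := c_im F FF.
  by rewrite !in_setD1 cA' c0 powersetE cA.
apply: leq_trans (subset_leq_card sB) _.
(* If [M :|: X] is empty, the two extremes coincide and [cardsD1] cannot subtract both. *)
have [A0|A0] := eqVneq (M :|: X) set0.
  have -> : B = set0 by rewrite /B A0 powerset0; apply/setP=> Z; rewrite !(in_setD1, inE); case: eqP.
  by rewrite cards0.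
have h8 : #|powerset (M :|: X)| <= 8.
  by rewrite card_powerset (leq_trans (leq_pexp2l _ cardMX)).
rewrite (cardsD1 set0) powersetE sub0set (cardsD1 (M :|: X)) in h8.
by rewrite in_setD1 A0 powersetE subxx in h8.
Qed.

Let Fam_min F : F \in Fam -> exists2 x, x \in F & x \in M.
Proof.
case/FamP=> /filled_lowerP[FY Fl _] /set0Pn[x xF] _.
have xY := subsetP FY x xF.
have [Dx0|/set0Pn[y yD]] := eqVneq (D x) set0.
  by exists x => //; rewrite inE xY Dx0 eqxx.
by exists y; [apply: (subsetP (Fl x xF))|apply: (subsetP (DM xY))].
Qed.

Let YMN x : x \in Y -> (x \in M) || (x \in N).
Proof. by rewrite !inE => ->; case: (D x == set0). Qed.

(** Without duplicates every upper element is governed by [top_rep], so the trace on [M] is a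
    faithful code. *)
Let no_X : X = set0 -> #|Fam| <= 6.
Proof.
move=> X0.
have nX x : x \notin X by rewrite X0 in_set0.
have hX x y : y \in X -> D y != D x by rewrite (negPf (nX y)).
apply: (card_Fam (c := fun F => F :&: M)) => [F F' FF FF' E|F FF].
  have [[fF _ _] [fF' _ _]] := (FamP FF, FamP FF').
  have [/filled_lowerP[FY Fl _] /filled_lowerP[FY' Fl' _]] := (fF, fF').
  have hM x : x \in M -> (x \in F) = (x \in F').
    by move=> xM; move/setP/(_ x): E; rewrite !in_setI xM !andbT.
  apply/setP=> x; have [xY|xY] := boolP (x \in Y); last first.
    by rewrite (contraNF (subsetP FY x)) ?(contraNF (subsetP FY' x)).
  have /orP[/hM//|xN] := YMN xY.
  rewrite (top_rep fF xN (nX x) (hX x)) (top_rep fF' xN (nX x) (hX x)).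
  apply/subsetP/subsetP => h z zD; have := h z zD; have zM := subsetP (DM xY) z zD;
    by rewrite hM.
rewrite X0 setU0 subsetIr; have [x xF xM] := Fam_min FF; split=> //.
  by apply/set0Pn; exists x; rewrite inE xF.
have [fF _] := FamP FF; apply: contraNneq => /setIidPr MF.
have /filled_lowerP[FY Fl _] := fF.
rewrite eqEsubset FY; apply/subsetP=> y yY.
have /orP[/(subsetP MF)//|yN] := YMN yY.
by rewrite (top_rep fF yN (nX y) (hX y)) (subset_trans (DM yY)).
Qed.

Let ex_X x0 : x0 \in X -> #|Fam| <= 6.
Proof.
move=> x0X; set E := D x0; have x0N := XN x0X; have x0Y := NY x0N.
have [rY rD] := repP x0Y; set r := rep x0 in rY rD.
have [e eE] : exists e, e \in E by apply/set0Pn; move: x0N; rewrite inE => /andP[].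
have eM : e \in M := subsetP (DM x0Y) e eE.
(* Two different duplicates leave room for only one minimal element, by [cardMX]; then every
   nonempty boundary is that singleton. *)
have XE x : x \in X -> D x = E.
  move=> xX; have [->//|xx0] := eqVneq x x0.
  have M1 : #|M| <= 1.
    have dMX : [disjoint M & X].
      by apply/pred0P=> z /=; apply/negP=> /andP[/MN zN /XN zN']; rewrite zN' in zN.
    have : 2 <= #|X|.
      have <- : #|[set x; x0]| = 2 by rewrite cards2 xx0.
      by apply/subset_leq_card/subsetP=> z /set2P[]->.
    have := cardMX; rewrite cardsU disjoint_setI0 // cards0; lia.
  have D1 y : y \in N -> D y = [set e].
    move=> yN; have /subset_leq_card := DM (NY yN); move=> /leq_trans/(_ M1) yc.
    have MeE : M = [set e].
      by apply/eqP; rewrite eq_sym eqEcard sub1set eM cards1.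
    apply/eqP; move: (DM (NY yN)); rewrite MeE subset1 => /orP[//|].
    by move: yN; rewrite inE => /andP[_ /negPf->].
  by rewrite /E !D1 // XN.
have rX : r \notin X by apply: repX.
have rN : r \in N by rewrite inE rY rD; move: x0N; rewrite inE => /andP[].
have rM : r \notin M by apply: contraL rN => /MN.
have eX : e \notin X by apply/negP=> /XN; apply/negP/MN.
have repE y : y \in Y -> D y = E -> rep y = r by move=> yY h; apply: rep_eq.
(* As all of [X] lies over [E], a filled lower set is determined by its trace
   on [M :|: X] and by whether it contains [r].  When [E] is contained in [F] the
   membership of [e] carries no information, so [c] uses it to record [r]. *)
pose c F := F :&: (M :|: X) :\: [set z | (z == e) && (r \notin F) && (E \subset F)].
have cX F x : x \in X -> (x \in c F) = (x \in F).
  move=> xX; rewrite in_setD in_setI in_setU xX orbT andbT inE.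
  by have -> : x == e = false by apply: contraNF eX => /eqP<-.
have cM F x : x \in M -> x != e -> (x \in c F) = (x \in F).
  by move=> xM /negPf xe; rewrite in_setD in_setI in_setU xM andbT inE xe.
have ce F : (e \in c F) = (e \in F) && ~~ ((r \notin F) && (E \subset F)).
  by rewrite in_setD in_setI in_setU eM andbT inE eqxx andbC.
have FE F y : filled_lower Y D F -> y \in F -> y \in X -> E \subset F.
  by move=> /filled_lowerP[_ Fl _] /Fl + /XE => /[swap] ->.
have Er F : filled_lower Y D F -> r \in F -> E \subset F.
  by move=> /filled_lowerP[_ Fl _] /Fl; rewrite rD.
have rE F : filled_lower Y D F -> E \subset F -> (r \notin F) ->
    exists2 y, y \in X & y \in F.
  move=> /filled_lowerP[FY _ Ff] /(Ff x0 x0Y)[y yF yE] rF; exists y => //.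
  have yY := subsetP FY y yF.
  rewrite in_setX_rep inE yY yE repE //; move: x0N; rewrite inE => /andP[_ ->] /=.
  by apply: contraNneq rF => ->.
(* [decE] recovers [E \subset F] from the code: either [r] is in [F] and nothing was removed, or
   filledness puts an element of [X] into [F], and conversely such an element brings [E] with it. *)
pose decE (K : {set T}) := (E \subset K) || [exists y in X, y \in K].
have decEP F : filled_lower Y D F -> (E \subset F) = decE (c F).
  move=> fF; rewrite /decE; apply/idP/orP => [EF|[EF|]].
  - have [rF|rF] := boolP (r \in F).
      left; apply/subsetP=> z zE; have zM := subsetP (DM x0Y) z zE.
      have zF := subsetP EF z zE.
      by have [->|ze] := eqVneq z e; [rewrite ce rF (subsetP EF)|rewrite cM].
    have [y yX yF] := rE F fF EF rF.
    by right; apply/existsP; exists y; rewrite yX cX.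
  - by apply: subset_trans EF _; apply/subsetP=> z /setDP[/setIP[]].
  - by move=> /existsP[y /andP[yX]]; rewrite cX // => yF; apply: FE yX.
(* When [decE] holds, [e] is certainly in [F] and its bit means [r \in F]; otherwise the bit keeps
   its usual meaning and [r] is absent. *)
have e_dec F : filled_lower Y D F -> (e \in F) = decE (c F) || (e \in c F).
  move=> fF; rewrite -decEP // ce; have [EF|EF] := boolP (E \subset F).
    by rewrite (subsetP EF).
  by rewrite andbF andbT.
have r_dec F : filled_lower Y D F -> (r \in F) = decE (c F) && (e \in c F).
  move=> fF; rewrite -decEP // ce; apply/idP/andP => [rF|[EF]].
    by rewrite rF (Er F) // (subsetP (Er F fF rF)).
  by rewrite EF andbT negbK => /andP[].
have z_dec F z : filled_lower Y D F -> z \in N -> z \notin X -> z != r ->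
    (z \in F) = (D z \subset F).
  move=> fF zN zX zr; apply: top_rep => // y yX; rewrite (XE y yX) eq_sym.
  apply/eqP=> zE; have zY := NY zN; move: zX; rewrite in_setX_rep zN repE //=.
  by rewrite negbK eq_sym (negPf zr).
apply: (card_Fam (c := c)) => [F F' /FamP[fF _ _] /FamP[fF' _ _] cE|F FF].
  have [/filled_lowerP[FY _ _] /filled_lowerP[FY' _ _]] := (fF, fF').
  have hM x : x \in M -> (x \in F) = (x \in F').
    by move=> xM; have [->|xe] := eqVneq x e; 
      [rewrite (e_dec F) // (e_dec F') // cE|rewrite -(cM F) // -(cM F') // cE].
  apply/setP=> x; have [xY|xY] := boolP (x \in Y); last first.
    by rewrite (contraNF (subsetP FY x)) ?(contraNF (subsetP FY' x)).
  have /orP[/hM//|xN] := YMN xY.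
  have [xX|xX] := boolP (x \in X); first by rewrite -(cX F) // -(cX F') // cE.
  have [->|xr] := eqVneq x r; first by rewrite (r_dec F) // (r_dec F') // cE.
  rewrite (z_dec F) // (z_dec F') //.
  apply/subsetP/subsetP => h z zD; have := h z zD; have zM := subsetP (DM xY) z zD;
    by rewrite hM.
have [fF _ FnY] := FamP FF; split.
- by apply/subsetP=> z /setDP[/setIP[]].
- have [x xF xM] := Fam_min FF; have [xe|xe] := eqVneq x e; last first.
    by apply/set0Pn; exists x; rewrite cM.
  move: (e_dec F fF); rewrite -xe xF => /esym/orP[|xc]; last by apply/set0Pn; exists x.
  rewrite /decE => /orP[EF|/existsP[y /andP[_ yc]]]; apply/set0Pn.
    by exists e; apply: (subsetP EF).
  by exists y.
- apply: contraNneq FnY => cA.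
  have /filled_lowerP[FY _ _] := fF.
  have EM : decE (c F) by rewrite /decE cA (subset_trans (DM x0Y)) ?subsetUl.
  have ec : e \in c F by rewrite cA inE eM.
  have MF : M \subset F.
    apply/subsetP=> x xM; have [->|xe] := eqVneq x e; first by rewrite e_dec // EM.
    by rewrite -cM // cA inE xM.
  rewrite eqEsubset FY; apply/subsetP=> x xY.
  have /orP[/(subsetP MF)//|xN] := YMN xY.
  have [xX|xX] := boolP (x \in X); first by rewrite -cX // cA inE xX orbT.
  have [->|xr] := eqVneq x r; first by rewrite r_dec // EM.
  by rewrite z_dec // (subset_trans (DM xY)).
Qed.

Lemma card_filled_lower :
  #|[set F | [&& filled_lower Y D F, F != set0 & F != Y]]| <= 6.
Proof.
have [/no_X//|/set0Pn[x0 /ex_X//]] := eqVneq X set0.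
Qed.

End TwoLevel.

(** * Tubings *)

Section Tubings.
Context {disp : Order.disp_t} {P : finPOrderType disp}.
Implicit Types (x y z : P) (A B C F L : {set P}) (S T : {set {set P}}).
Local Open Scope order_scope.

Lemma lower_setP L : reflect (forall x y, x \in L -> y <= x -> y \in L) (lower_set L).
Proof.
apply: (iffP forallP) => h x; last first.
  by apply/implyP=> xL; apply/forallP=> y; apply/implyP; apply: h.
by move=> y xL; move: (h x); rewrite xL => /forallP/(_ y)/implyP.
Qed.

Lemma filledP L :
  reflect (forall x, boundary x \subset L -> exists2 y, y \in L & boundary y = boundary x)
          (filled L).
Proof.
apply: (iffP forallP) => h x.
  move=> bL; move: (h x); rewrite bL => /set0Pn[y]; rewrite !inE => /andP[yL /eqP e].
  by exists y.
apply/implyP=> /h[y yL e]; apply/set0Pn; exists y.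
by rewrite inE yL inE e eqxx.
Qed.

Lemma in_boundary x y : (y \in boundary x) = (y < x).
Proof. by rewrite inE. Qed.

Lemma filled_lower_setT F : filled_lower setT boundary F = lower_set F && filled F.
Proof.
apply/filled_lowerP/andP => [[_ Fl Ff]|[/lower_setP Fl /filledP Ff]]; split.
- apply/lower_setP=> x y xF; rewrite le_eqVlt => /orP[/eqP->//|yx].
  by apply: (subsetP (Fl x xF)); rewrite in_boundary.
- by apply/filledP=> x; apply: Ff; rewrite inE.
- exact: subsetT.
- by move=> x xF; apply/subsetP=> y; rewrite in_boundary => /ltW; apply: Fl.
- by move=> x _; apply: Ff.
Qed.

Definition adj_in L : rel P := [rel u v | [&& u \in L, v \in L & hasse_adj u v]].

Lemma adj_in_sym L : symmetric (adj_in L).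
Proof. by move=> x y; rewrite /adj_in /hasse_adj /= andbCA orbC. Qed.

Lemma connect_adjC L : connect_sym (adj_in L).
Proof. apply: sym_connect_sym; apply: adj_in_sym. Qed.

(** Induction on the size of the interval from [y] to [x]: an element strictly between splits it
    into two smaller intervals, and if there is none the pair is a covering. *)
Lemma connect_lower L x y : lower_set L -> x \in L -> y <= x -> connect (adj_in L) y x.
Proof.
move=> /lower_setP Ll; have [n] := ubnP #|[set z | y <= z & z <= x]|.
elim: n x y => // n IH x y; rewrite ltnS => nx xL; rewrite le_eqVlt => /orP[/eqP->//|yx].
have [/existsP[z /andP[yz zx]]|no] := boolP [exists z, (y < z) && (z < x)].
  have zL := Ll _ _ xL (ltW zx).
  apply: (@connect_trans _ _ z); apply: IH => //; rewrite ?ltW //.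
    apply: leq_trans nx; apply/proper_card/properP; split.
      by apply/subsetP=> w; rewrite !inE => /andP[-> /le_trans-> //]; apply: ltW.
    by exists x; rewrite !inE ?lexx ?(ltW yx) // (lt_geF zx) andbF.
  apply: leq_trans nx; apply/proper_card/properP; split.
    by apply/subsetP=> w; rewrite !inE => /andP[/(le_trans (ltW yz))-> ->].
  by exists y; rewrite !inE ?lexx ?(ltW yx) // (lt_geF yz).
apply: connect1; rewrite /adj_in /= xL (Ll _ _ xL (ltW yx)) /=.
by rewrite /hasse_adj /= /covers yx no.
Qed.

Lemma connected_root L c : (forall x, x \in L -> connect (adj_in L) c x) -> hasse_connected L.
Proof.
move=> h; apply/forallP=> x; apply/implyP=> xL; apply/forallP=> y; apply/implyP=> yL.
by apply: (@connect_trans _ _ c); [rewrite connect_adjC|]; apply: h.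
Qed.

Lemma connectedP L x y : hasse_connected L -> x \in L -> y \in L -> connect (adj_in L) x y.
Proof.
by move=> /forallP/(_ x)/implyP h xL yL; have /forallP/(_ y)/implyP := h xL; apply.
Qed.

Lemma connect_adjS L L' x y : L \subset L' -> connect (adj_in L) x y -> connect (adj_in L') x y.
Proof.
move=> LL'; apply: connect_sub => u v /and3P[uL vL uv]; apply: connect1.
by rewrite /adj_in /= !(subsetP LL').
Qed.

Definition component F x := [set y | connect (adj_in F) x y].

Lemma component_sub F x : x \in F -> component F x \subset F.
Proof.
move=> xF; apply/subsetP=> y; rewrite inE => /connectP[p]; elim: p x xF => [|z p IH] x xF /=.
  by move=> _ ->.
by case/andP=> /and3P[_ zF _]; apply: IH.
Qed.

(** Every prefix of a path from [x] ends in the component, so the path never leaves it. *)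
Lemma connect_component F x y :
  connect (adj_in F) x y -> connect (adj_in (component F x)) x y.
Proof.
move=> /connectP[p]; elim/last_ind: p y => [|p z IH] y /=; first by move=> _ ->.
rewrite last_rcons rcons_path => /andP[pp zz] ->.
apply: (connect_trans (IH _ pp erefl)); apply: connect1.
have cl : connect (adj_in F) x (last x p) by apply/connectP; exists p.
by case/and3P: (zz) => _ _ uv; rewrite /adj_in /= !inE cl uv (connect_trans cl) ?connect1.
Qed.

Lemma min_in_lower L : lower_set L -> L != set0 -> exists2 x, x \in L & boundary x = set0.
Proof.
move=> /lower_setP Ll /set0Pn[x0 x0L].
have [x xL xm] := arg_minnP (fun x => #|boundary x|) x0L; exists x => //.
apply/setP=> y; rewrite in_boundary inE; apply/negP=> yx.
have /xm := Ll _ _ xL (ltW yx); rewrite leqNgt => /negP[].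
apply/proper_card/properP; split.
  by apply/subsetP=> z; rewrite !in_boundary => /lt_trans->.
by exists y; rewrite !in_boundary // ltxx.
Qed.

Lemma filled_lower_min F : filled_lower setT boundary F -> F != set0 ->
  exists2 x, x \in F & boundary x = set0.
Proof. by rewrite filled_lower_setT => /andP[/min_in_lower]. Qed.

(** For filledness, an element of [F] with nonempty boundary inside the component is joined to the
    component through that boundary; the empty boundary is filled by a minimal element of the
    component. *)
Lemma component_tube F x : filled_lower setT boundary F -> x \in F -> tube (component F x).
Proof.
rewrite filled_lower_setT => /andP[Fl Ff] xF; have Cs := component_sub xF.
have Cl : lower_set (component F x).
  apply/lower_setP=> y z yC zy; rewrite inE; move: (yC); rewrite inE => /connect_trans-> //.
  by rewrite connect_adjC connect_lower // (subsetP Cs).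
apply/and3P; split=> //.
  have C0 : component F x != set0 by apply/set0Pn; exists x; rewrite inE connect0.
  apply/filledP=> y yC; have [y0|/set0Pn[z zy]] := eqVneq (boundary y) set0.
    by rewrite y0; apply: min_in_lower.
  have [w wF wy] := filledP _ Ff y (subset_trans yC Cs); exists w => //.
  have zC := subsetP yC z zy; rewrite inE; move: (zC); rewrite inE => /connect_trans-> //.
  by rewrite connect_lower // ltW // -in_boundary wy.
by apply: (@connected_root _ x) => y; rewrite inE => /connect_component.
Qed.

Lemma tube_filled_lower A : tube A -> filled_lower setT boundary A.
Proof. by rewrite filled_lower_setT => /and3P[-> ->]. Qed.

Lemma tubingP T :
  reflect [/\ forall A, A \in T -> tube A /\ A != setT,
              forall A B, A \in T -> B \in T -> [|| [disjoint A & B], A \subset B | B \subset A]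
            & forall S, S \subset T -> S != set0 -> filled (cover S)]
          (tubing T).
Proof.
apply: (iffP and3P) => -[hT hN hF]; split.
- by move=> A AT; have /andP[] := implyP (forallP hT A) AT.
- by move=> A B AT BT; have /forallP/(_ B)/implyP := implyP (forallP hN A) AT; apply.
- by move=> S ST S0; apply: (implyP (forallP hF S)); rewrite ST S0.
- by apply/forallP=> A; apply/implyP=> /hT[-> ->].
- by apply/forallP=> A; apply/implyP=> AT; apply/forallP=> B; apply/implyP; apply: hN.
- by apply/forallP=> S; apply/implyP=> /andP[]; apply: hF.
Qed.

Lemma tubingS S T : S \subset T -> tubing T -> tubing S.
Proof.
move=> /subsetP ST /tubingP[hT hN hF]; apply/tubingP; split.
- by move=> A /ST/hT.
- by move=> A B /ST AT /ST BT; apply: hN.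
- by move=> S' S'S; apply: hF; apply/subsetP=> A /(subsetP S'S)/ST.
Qed.

Lemma sub_cover A S : A \in S -> A \subset cover S.
Proof. by move=> AS; apply: (bigcup_sup A). Qed.

(** The union of a nonempty nested family is its largest member, hence filled. *)
Lemma nested_tubing T :
  {in T, forall A, tube A /\ A != setT} -> {in T &, forall A B, (A \subset B) || (B \subset A)} ->
  tubing T.
Proof.
move=> hT hN; apply/tubingP; split=> // [A B AT BT|S ST /set0Pn[A0 A0S]].
  by rewrite hN ?orbT.
have [A AS Am] := arg_maxnP (fun A : {set P} => #|A|) A0S.
suff -> : cover S = A by have [/and3P[]] := hT _ (subsetP ST _ AS).
apply/eqP; rewrite eqEsubset; apply/andP; split; last exact: sub_cover.
apply/bigcupsP=> B BS; have /orP[//|AB] := hN _ _ (subsetP ST _ BS) (subsetP ST _ AS).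
have /eqP-> // : A == B by rewrite eqEcard AB; exact: Am.
Qed.

Lemma tubing1 A : tubing [set A] = tube A && (A != setT).
Proof.
apply/idP/andP => [/tubingP[/(_ A)h _ _]|[tA A1]]; first by apply: h; rewrite inE.
by apply: nested_tubing => [B|B C]; rewrite !inE => /eqP-> // /eqP->; rewrite subxx.
Qed.

(** The union of nested tubes is one of them, so filledness of the union is a condition only on
    disjoint pairs. *)
Lemma tubing2P A B :
  reflect [/\ tube A /\ A != setT, tube B /\ B != setT &
           [\/ A \subset B, B \subset A | [disjoint A & B] /\ filled (A :|: B)]]
          (tubing [set A; B]).
Proof.
apply: (iffP idP) => [/tubingP[hT hN hF]|[hA hB h]].
  have AAB := set21 A B; have BAB := set22 A B.
  split; [exact: hT|exact: hT|].
  have /or3P[AB|AB|AB] := hN _ _ AAB BAB; [|by constructor 1|by constructor 2].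
  constructor 3; split=> //; have [E|nAB] := eqVneq A B.
    by rewrite E setUid; have [/and3P[]] := hT _ BAB.
  have -> : A :|: B = cover [set A; B] by rewrite /cover big_setU1 ?inE ?big_set1.
  by apply: hF => //; apply/set0Pn; exists A.
have nest : (A \subset B) || (B \subset A) -> tubing [set A; B].
  move=> n; apply: nested_tubing => [C /set2P[]->//|C D /set2P[]-> /set2P[]->];
    by rewrite ?subxx // orbC.
case: h => [h|h|[dAB fAB]]; [by apply: nest; rewrite h|by apply: nest; rewrite h orbT|].
apply/tubingP; split.
- by move=> C /set2P[]->.
- by move=> C D /set2P[]-> /set2P[]->; rewrite ?subxx ?orbT // ?dAB // disjoint_sym dAB.
move=> S SAB S0.
have [fA fB] : filled A /\ filled B by case: hA hB => /and3P[_ -> _] _ [/and3P[_ -> _] _].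
have [AS|AS] := boolP (A \in S); have [BS|BS] := boolP (B \in S).
- have -> // : cover S = A :|: B.
  apply/eqP; rewrite eqEsubset subUset; apply/and3P; split; try exact: sub_cover.
  by apply/bigcupsP=> C /(subsetP SAB) /set2P[]->; rewrite ?subsetUl ?subsetUr.
- have -> // : cover S = A.
  apply/eqP; rewrite eqEsubset; apply/andP; split; last exact: sub_cover.
  by apply/bigcupsP=> C CS; have /set2P[->//|E] := subsetP SAB C CS; rewrite -E CS in BS.
- have -> // : cover S = B.
  apply/eqP; rewrite eqEsubset; apply/andP; split; last exact: sub_cover.
  by apply/bigcupsP=> C CS; have /set2P[E|->//] := subsetP SAB C CS; rewrite -E CS in AS.
- case/set0Pn: S0 => C CS; have /set2P[E|E] := subsetP SAB C CS.
    by rewrite -E CS in AS.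
  by rewrite -E CS in BS.
Qed.

(* The new tube is the component in [F'] of an element outside [F]. *)
Lemma tubing_add T F F' :
  tubing T -> (forall A, A \in T -> A \subset F) -> F \proper F' -> F' != setT ->
  filled_lower setT boundary F' ->
  exists T', [/\ tubing T', #|T'| = #|T|.+1 & forall A, A \in T' -> A \subset F'].
Proof.
move=> /tubingP[hT hN hF] TF /properP[FF' [x xF' xF]] F'T fF'.
set C := component F' x.
have tC : tube C by apply: component_tube.
have xC : x \in C by rewrite inE connect0.
have CF' : C \subset F' := component_sub xF'.
have CT : C \notin T by apply: contra xF => /TF/subsetP; apply.
have CnT : C != setT by apply: contraNneq F'T => E; rewrite -subTset -E.
have [/lower_setP Cl Cf _] := and3P tC.
have F'l : lower_set F' by move: fF'; rewrite filled_lower_setT => /andP[].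
have hC A : A \in T -> [disjoint A & C] || (A \subset C).
  move=> AT; have [[tA _] AF] := (hT A AT, TF A AT).
  have [//|/pred0Pn[y /andP[/= yA yC]]] := boolP [disjoint A & C].
  apply/subsetP=> z zA; rewrite inE; move: yC; rewrite inE => /connect_trans->//.
  apply: connect_adjS (subset_trans AF FF') _.
  by apply: connectedP => //; case/and3P: tA.
exists (C |: T); split; last 1 first.
- by move=> A /setU1P[->//|/TF/subset_trans->].
- apply/tubingP; split.
  + by move=> A /setU1P[->|/hT].
  + move=> A B /setU1P[->|AT] /setU1P[->|BT]; first by rewrite subxx !orbT.
    * by rewrite disjoint_sym; have /orP[->|->] := hC B BT; rewrite ?orbT.
    * by have /orP[->|->] := hC A AT; rewrite ?orbT.
    * exact: hN.
  + move=> S ST S0; have [CS|CS] := boolP (C \in S); last first.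
      apply: hF => //; apply/subsetP=> A AS.
      by have /setU1P[E|//] := subsetP ST A AS; rewrite -E AS in CS.
    have CcS : C \subset cover S by apply: sub_cover.
    have S'T : S :\ C \subset T by rewrite subDset.
    have cS' : cover (S :\ C) \subset cover S.
      by apply/bigcupsP=> A /setD1P[_ AS]; apply: sub_cover.
    have cSF' : cover S \subset F'.
      by apply/bigcupsP=> A /(subsetP ST) /setU1P[->//|/TF/subset_trans->].
    apply/filledP=> y yS.
    (* Three cases: an empty boundary is filled by a minimal element of [C]; a boundary meeting [C]
       is filled in [F'] by an element that then belongs to [C]; any other boundary lies in the
       union of the tubes of [S] other than [C], which is filled because [T] is a tubing. *)
    have [y0|y0] := eqVneq (boundary y) set0.
      have C0 : C != set0 by apply/set0Pn; exists x.
      have [|z zC z0] := min_in_lower _ C0; first exact/lower_setP.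
      rewrite y0; by exists z => //; apply: (subsetP CcS).
    have [/existsP[z /andP[zy zC]]|no] := boolP [exists z in boundary y, z \in C].
      have [_ _ F'f] := filled_lowerP _ _ _ fF'.
      have [||w wF' wy] := F'f y; rewrite ?inE //; first exact: subset_trans cSF'.
      exists w => //; apply: (subsetP CcS); rewrite inE.
      move: (zC); rewrite inE => /connect_trans->//.
      by apply: connect_lower => //; rewrite ltW // -in_boundary wy.
    have yS' : boundary y \subset cover (S :\ C).
      apply/subsetP=> z zy; have /bigcupP[A AS zA] := subsetP yS z zy.
      apply/bigcupP; exists A => //; rewrite !inE AS andbT.
      apply: contraNneq no => EAC; apply/existsP; exists z; rewrite zy -EAC //.
    have S'0 : S :\ C != set0.
      case/set0Pn: y0 => z /(subsetP yS')/bigcupP[A AS' _].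
      by apply/set0Pn; exists A.
    have [w wS' wy] := filledP _ (hF _ S'T S'0) y yS'.
    by exists w => //; apply: (subsetP cS').
- by rewrite cardsU1 CT.
Qed.

(** Iterates [tubing_add] from the empty tubing inside the empty set; nonemptiness of [F1] makes the
    first step strict. *)
Lemma four_tubing F1 F2 F3 F4 :
  filled_lower setT boundary F1 -> filled_lower setT boundary F2 ->
  filled_lower setT boundary F3 -> filled_lower setT boundary F4 ->
  F1 != set0 -> F1 \proper F2 -> F2 \proper F3 -> F3 \proper F4 -> F4 != setT ->
  exists2 T : {set {set P}}, tubing T & #|T| = 4.
Proof.
move=> f1 f2 f3 f4 F10 F12 F23 F34 F4T.
have nT A B : A \proper B -> A != setT.
  by case/properP=> _ [x _ xA]; apply: contraNneq xA => ->; rewrite inE.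
have t0 : tubing (set0 : {set {set P}}).
  by apply: nested_tubing => [A|A B]; rewrite inE.
have [||||T1 [t1 c1 h1]] := @tubing_add set0 set0 F1 t0; rewrite ?proper0 ?(nT _ _ F12) //.
  by move=> A; rewrite inE.
have [||T2 [t2 c2 h2]] := tubing_add t1 h1 F12; rewrite ?(nT _ _ F23) //.
have [||T3 [t3 c3 h3]] := tubing_add t2 h2 F23; rewrite ?(nT _ _ F34) //.
have [|T4 [t4 c4 h4]] := tubing_add t3 h3 F34 F4T; rewrite //.
by exists T4 => //; rewrite c4 c3 c2 c1 cards0.
Qed.

End Tubings.

(** * Posets of height two *)

(** [k + 7] is [k - 1] modulo 8. The relation is reflexive since a side paired with itself is a
    tubing. *)
Definition side_adj (k l : nat) : bool :=
  l \in [:: k; (k + 1) %% 8; (k + 7) %% 8].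

(** Each vertex of the 8-cycle excludes three vertices, so two exclude at most six. This is the form
    in which [cap_no_sub] uses that the cycle is not a join. *)
Lemma side_adj_far (k l : 'I_8) : exists m : 'I_8, ~~ side_adj k m && ~~ side_adj l m.
Proof.
have : all (fun a => all (fun b => has (fun c => ~~ side_adj a c && ~~ side_adj b c)
  (iota 0 8)) (iota 0 8)) (iota 0 8) by vm_compute.
move=> /allP/(_ k) h; have /h/allP/(_ l) {}h : (k : nat) \in iota 0 8 by rewrite mem_iota add0n ltn_ord.
have /h/hasP[m] : (l : nat) \in iota 0 8 by rewrite mem_iota add0n ltn_ord.
by rewrite mem_iota => m8; exists (Ordinal m8).
Qed.

Lemma set1_neq0 (T : finType) (z : T) : [set z] <> set0.
Proof. by move/setP/(_ z); rewrite !inE eqxx. Qed.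

Section HeightTwo.
Context {disp : Order.disp_t} {P : finPOrderType disp}.
Implicit Types (x y z : P) (A B C F L Y : {set P}).
Local Open Scope order_scope.
Local Notation fill := (filled_lower setT boundary).

Hypothesis ht2 : forall x y z, x < y -> y < z -> False.

Lemma boundary_min x y : y \in boundary x -> boundary y = set0.
Proof.
rewrite in_boundary => yx; apply/setP=> z; rewrite in_boundary inE.
by apply/negP=> /ht2/(_ yx).
Qed.

Lemma filled_lower_trans Y F : fill Y -> filled_lower Y boundary F -> fill F.
Proof.
move=> /filled_lowerP[_ _ Yf] /filled_lowerP[FY Fl Ff]; apply/filled_lowerP; split=> // x _ xF.
 have [|y yY yx] := Yf x _ (subset_trans xF FY); first by rewrite inE.
by have [|w wF wy] := Ff y yY; rewrite ?yx //; exists w; rewrite ?wy.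
Qed.

Lemma filled_lower_sub Y F : fill F -> F \subset Y -> filled_lower Y boundary F.
Proof.
move=> /filled_lowerP[_ Fl Ff] FY; apply/filled_lowerP; split=> // x xY; apply: Ff.
by rewrite inE.
Qed.

(** A minimal element [u] of [U] together with one element of [U] over [[set u]], if there is any,
    is already a tube: boundaries inside it are empty or [[set u]]. By minimality it is all of
    [U]. *)
Lemma minimal_tube U : tube U -> U != set0 -> (forall A, tube A -> A \subset U -> A = U) ->
  exists u S, [/\ boundary u = set0, U = u |: S, #|S| <= 1 &
    forall x, x \in S -> boundary x = [set u]]%N.
Proof.
move=> tU U0 Um; have fU := tube_filled_lower tU.
have [u uU u0] := filled_lower_min fU U0.
have [_ Ul Uf] := filled_lowerP _ _ _ fU.
(* [S] holds the element returned by [pick], and is empty when the search fails. *)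
pose S := [set s | [pick s in U | boundary s == [set u]] == Some s].
have SP s : s \in S -> s \in U /\ boundary s = [set u].
  by rewrite inE; case: pickP => // w /andP[wU /eqP wu] /eqP[<-].
exists u, S; split=> //; last by move=> x /SP[].
  symmetry; apply: Um; last first.
    by rewrite subUset sub1set uU; apply/subsetP=> s /SP[].
  have lt_ : lower_set (u |: S).
    apply/lower_setP=> x y xt; rewrite le_eqVlt => /orP[/eqP->//|]; rewrite -in_boundary.
    case/setU1P: xt => [->|/SP[_ ->]]; first by rewrite u0 inE.
    by move=> /set1P->; rewrite setU11.
  apply/and3P; split=> //.
    apply/filledP=> x xt; have [x0|x0] := eqVneq (boundary x) set0.
      by exists u; rewrite ?setU11 ?u0.
    have xu : boundary x = [set u].
      apply/eqP; have : boundary x \subset [set u].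
        apply/subsetP=> z zx; have /setU1P[->|/SP[_ zu]] := subsetP xt z zx.
          by rewrite inE.
        by have := boundary_min zx; rewrite zu => /setP/(_ u); rewrite !inE eqxx.
      by rewrite subset1 (negPf x0) orbF.
    have [||y yU yx] := Uf x; rewrite ?inE ?xu ?sub1set //.
    case E: [pick s in U | boundary s == [set u]] => [s|].
      have sS : s \in S by rewrite inE E.
      by exists s; rewrite ?inE ?E ?eqxx ?orbT //; have [] := SP s sS.
    by move: E; case: pickP => // /(_ y); rewrite yU yx xu eqxx.
  apply: (@connected_root _ _ _ u) => x xt; apply: connect_lower => //.
  case/setU1P: xt => [->//|/SP[_ xu]].
  by rewrite ltW // -in_boundary xu inE.
rewrite leqNgt; apply/negP=> /card_gt1P[x [y [xS yS /eqP[]]]].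
by move: xS yS; rewrite !inE => /eqP-> /eqP[].
Qed.

(** [U] and [V] are the caps and [W] the sides in cyclic order; the hypotheses describe the
    suspension of an 8-cycle, the complex dual to the prism. *)
Variables (U V : {set P}) (W : 'I_8 -> {set P}).
Hypothesis W_inj : injective W.
Hypothesis WU : forall k, W k != U.
Hypothesis WV : forall k, W k != V.
Hypothesis tubes_UVW : forall A, tube A -> A != setT -> [\/ A = U, A = V | exists k, A = W k].
Hypothesis UW : forall k, tubing [set U; W k].
Hypothesis VW : forall k, tubing [set V; W k].
Hypothesis UV : ~~ tubing [set U; V].
Hypothesis WW : forall k l, tubing [set W k; W l] -> side_adj k l.
Hypothesis tubing_card : forall T : {set {set P}}, tubing T -> #|T| <= 3.

Let nonempty A : tube A -> A != setT -> A != set0.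
Proof.
move=> /and3P[_ /filledP Af _] A1; apply: contraNneq A1 => A0.
apply/eqP/setP=> x; rewrite A0 in_set0 in_setT.
have [||y _ y0] := @min_in_lower _ _ [set: P].
- by apply/lower_setP=> *; rewrite inE.
- by apply/set0Pn; exists x; rewrite inE.
have [|z] := Af y; first by rewrite y0 sub0set.
by rewrite A0 inE.
Qed.

Let no_chain4 F1 F2 F3 F4 : fill F1 -> fill F2 -> fill F3 -> fill F4 ->
  F1 != set0 -> F1 \proper F2 -> F2 \proper F3 -> F3 \proper F4 -> F4 != setT -> False.
Proof.
move=> f1 f2 f3 f4 F10 F12 F23 F34 F4T.
have [T /tubing_card + c4] := four_tubing f1 f2 f3 f4 F10 F12 F23 F34 F4T.
by rewrite c4.
Qed.

(** A chain of three proper subsets of [Y] becomes a chain of four in [P] by adding [Y], so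
    [card_filled_lower] applies. *)
Let few_in Y : fill Y -> Y != setT ->
  #|[set F | [&& filled_lower Y boundary F, F != set0 & F != Y]]| <= 6.
Proof.
move=> fY YT; have [_ Yl _] := filled_lowerP _ _ _ fY; apply: card_filled_lower => //.
- by move=> x y _; apply: boundary_min.
- move=> F1 F2 F3 /(filled_lower_trans fY) f1 /(filled_lower_trans fY) f2 /(filled_lower_trans fY) f3.
  move=> F10 F12 F23 F3Y.
  exact: no_chain4 f1 f2 f3 fY F10 F12 F23 F3Y YT.
Qed.

(** The common contradiction: [g] will be the sides themselves or their traces on a smaller
    structure. *)
Let eight Y D (g : 'I_8 -> {set P}) : injective g ->
  (forall k, [/\ filled_lower Y D (g k), g k != set0 & g k != Y]) ->
  #|[set F | [&& filled_lower Y D F, F != set0 & F != Y]]| <= 6 -> False.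
Proof.
move=> g_inj gP; apply/negP; rewrite -ltnNge.
apply: (@leq_trans 8%N) => //; have <- : #|g @: setT| = 8%N by rewrite card_imset // cardsT card_ord.
apply: subset_leq_card; apply/subsetP=> _ /imsetP[k _ ->].
by rewrite inE; apply/and3P; apply: gP.
Qed.

Let tW k : tube (W k) /\ W k != setT.
Proof. by have [_ []] := tubing2P _ _ (UW k). Qed.

Let W0 k : W k != set0. Proof. by have [h1 h2] := tW k; apply: nonempty. Qed.

(* Sides inside the cap are compatible with those outside it, but the 8-cycle
   is not complete bipartite. *)
Let cap_no_sub C k : (forall l, tubing [set C; W l]) -> (forall l, W l != C) ->
  ~~ (W k \subset C).
Proof.
move=> CW WC; apply/negP=> kC.
have [[tC CT] _ _] := tubing2P _ _ (CW k).
have [/forallP all_in|] := boolP [forall l, W l \subset C].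
  apply: (eight W_inj _ (few_in (tube_filled_lower tC) CT)) => l; split=> //.
  by apply: filled_lower_sub; rewrite ?tube_filled_lower //; case: (tW l).
rewrite negb_forall => /existsP[l lC].
(* A side inside [C] and one not inside are compatible: the outer one contains [C], or is disjoint
   from it with filled union, and this passes to the inner side. *)
have ab a b : W a \subset C -> ~~ (W b \subset C) -> side_adj a b /\ side_adj b a.
  move=> aC bC; suff t : tubing [set W a; W b].
    by split; apply: WW; rewrite // setUC.
  apply/tubing2P; split; try exact: tW.
  have [_ _ []] := tubing2P _ _ (CW b); last 2 first.
  - by move=> h; rewrite h in bC.
  - move=> [dCb fCb]; constructor 3; split.
      by apply: disjointWl dCb.
    have lC' : lower_set C by case/and3P: tC.
    have Wf : filled (W a) by have [/and3P[]] := tW a.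
    apply/filledP=> x xab.
    have [|y /setUP[yC|yb] yx] := filledP _ fCb x.
    + by apply: subset_trans xab _; apply: setSU.
    (* A filler from [C] puts the boundary inside [C], hence off [W b], so [W a] alone fills it. *)
    + have xa : boundary x \subset W a.
        apply/subsetP=> z zx; have /setUP[//|zb] := subsetP xab z zx.
        have zC : z \in C by apply: (lower_setP _ lC' y) => //; rewrite ltW // -in_boundary yx.
        by have := disjointFr dCb zC; rewrite zb.
      by have [w wa wx] := filledP _ Wf x xa; exists w; rewrite ?inE ?wa.
    + by exists y; rewrite ?inE ?yb ?orbT.
  - by move=> Cb; constructor 1; apply: subset_trans Cb.
(* Whether [W m] is inside [C] or not, it is compatible with one of [W l] and [W k], though [m] is
   far from both. *)
have [m /andP[km lm]] := side_adj_far k l.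
have [mC|mC] := boolP (W m \subset C).
  by have [_ h] := ab m l mC lC; rewrite h in lm.
by have [h _] := ab k m kC mC; rewrite h in km.
Qed.

Let tU : tube U /\ U != setT.
Proof. by have [] := tubing2P _ _ (UW ord0). Qed.
Let tV : tube V /\ V != setT.
Proof. by have [] := tubing2P _ _ (VW ord0). Qed.
Let noWU k : ~~ (W k \subset U). Proof. exact: cap_no_sub. Qed.
Let noWV k : ~~ (W k \subset V). Proof. exact: cap_no_sub. Qed.
Let noUV : ~~ (U \subset V).
Proof.
by apply: contra UV => h; apply/tubing2P; split=> //; constructor 1.
Qed.
Let noVU : ~~ (V \subset U).
Proof.
by apply: contra UV => h; apply/tubing2P; split=> //; constructor 2.
Qed.

Let cap_or C k : tubing [set C; W k] -> ~~ (W k \subset C) ->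
  (C \subset W k) || ([disjoint C & W k] && filled (C :|: W k)).
Proof.
by move=> /tubing2P[_ _ []] => [->//|h /negP//|[-> ->]]; rewrite orbT.
Qed.

(** Every other proper tube is [V] or a side, and none of these lies inside [U]. *)
Let Umin A : tube A -> A \subset U -> A = U.
Proof.
move=> tA AU; have AT : A != setT.
  by apply: contraNneq tU.2 => AT; rewrite -subTset -AT.
have [//|AV|[k Ak]] := tubes_UVW tA AT.
  by move: noVU; rewrite -AV AU.
by have := noWU k; rewrite -Ak AU.
Qed.

Let Vmin A : tube A -> A \subset V -> A = V.
Proof.
move=> tA AV; have AT : A != setT.
  by apply: contraNneq tV.2 => AT; rewrite -subTset -AT.
have [AU|//|[k Ak]] := tubes_UVW tA AT.
  by move: noUV; rewrite -AU AV.
by have := noWV k; rewrite -Ak AV.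
Qed.

Let cap_sub C k x : tubing [set C; W k] -> ~~ (W k \subset C) -> x \in C -> x \in W k ->
  C \subset W k.
Proof.
move=> /cap_or h /h /orP[//|/andP[d _]] xC xW.
by have := disjointFr d xC; rewrite xW.
Qed.

(* Delete the top element of [V]. *)
Let same_min u S S' : boundary u = set0 -> U = u |: S -> V = u |: S' ->
  #|S| <= 1 -> #|S'| <= 1 -> (forall x, x \in S -> boundary x = [set u]) ->
  (forall x, x \in S' -> boundary x = [set u]) -> False.
Proof.
move=> u0 EU EV S1 S'1 bS bS'.
(* Over the same [u], a cap without a top element would lie inside the other cap. *)
have [s sS] : exists s, s \in S.
  by apply/set0Pn; apply: contraNneq noUV => S0; rewrite EU EV S0 setU0 sub1set setU11.
have [s' s'S] : exists s, s \in S'.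
  by apply/set0Pn; apply: contraNneq noVU => S0; rewrite EU EV S0 setU0 sub1set setU11.
have sing (R : {set P}) x : x \in R -> #|R| <= 1 -> R = [set x].
  by move=> xR R1; apply/eqP; rewrite eq_sym eqEcard sub1set xR cards1.
have ss : s != s'.
  apply: contraNneq noUV => E; rewrite EU EV setUS //.
  by rewrite (sing S s) // sub1set E.
(* A side containing [u] meets both caps, hence contains both. *)
have VW' k : u \in W k -> s' \in W k.
  move=> uW; have h : V \subset W k by apply: (cap_sub (VW k) (noWV k) _ uW); rewrite EV setU11.
  by apply: (subsetP h); rewrite EV inE s'S orbT.
have UW' k : u \in W k -> s \in W k.
  move=> uW; have h : U \subset W k by apply: (cap_sub (UW k) (noWU k) _ uW); rewrite EU setU11.
  by apply: (subsetP h); rewrite EU inE sS orbT.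
have us' : u != s' by apply/eqP=> E; have := bS' _ s'S; rewrite -E u0 => /esym/set1_neq0.
have s'b x : s' \notin boundary x.
  apply/negP=> /boundary_min; by rewrite (bS' _ s'S) => /set1_neq0.
have bs' x : boundary x = boundary s' -> x != s' -> x \in [set~ s'] by rewrite !inE.
have sY : s \in [set~ s'] by rewrite !inE.
have ss'b : boundary s = boundary s' by rewrite bS ?bS'.
(* [s] replaces [s'] as a filler of the boundary [[set u]]. *)
have fY : fill [set~ s'].
  apply/filled_lowerP; split=> //.
    by move=> x _; apply/subsetP=> y yx; rewrite !inE; apply: contraTneq yx => ->.
  move=> x _ _; have [->|xs'] := eqVneq x s'; first by exists s.
  by exists x; rewrite ?inE.
have YT : [set~ s'] != setT.
  by apply/eqP=> /setP/(_ s'); rewrite !inE eqxx.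
(* A side contains [s'] exactly when it contains [u], so deleting [s'] keeps the sides distinct. *)
apply: (eight (g := fun k => W k :\ s') _ _ (few_in fY YT)) => [k l E|k].
  apply: W_inj; apply/setP=> x; have [->|xs'] := eqVneq x s'; last first.
    by move/setP/(_ x): E; rewrite !inE xs'.
  have hu m : (s' \in W m) = (u \in W m :\ s').
    rewrite !inE us'; apply/idP/idP => [s'W|/VW'//].
    have [/and3P[/lower_setP Wl _ _] _] := tW m.
    by apply: Wl s'W _; rewrite ltW // -in_boundary bS' // inE.
  by rewrite !hu E.
have [/tube_filled_lower fW WT] := tW k; have [_ Wl Wf] := filled_lowerP _ _ _ fW.
split.
- apply/filled_lowerP; split.
  + by apply/subsetP=> x; rewrite !inE => /andP[].
  + move=> x /setD1P[_ /Wl xW]; apply/subsetP=> y yx; rewrite !inE (subsetP xW) // andbT.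
    by apply: contraTneq yx => ->.
  + move=> x _ xW; have [||y yW yx] := Wf x; rewrite ?inE //.
      exact: subset_trans xW (subsetDl _ _).
    have [ys'|ys'] := eqVneq y s'; last by exists y => //; rewrite !inE ys'.
    exists s; last by rewrite ss'b -ys'.
    rewrite !inE ss UW' //; suff : u \in W k :\ s' by case/setD1P.
    by apply: (subsetP xW); rewrite -yx ys' bS' // inE.
- have [x xW x0] := filled_lower_min fW (W0 k); apply/set0Pn; exists x; rewrite !inE xW andbT.
  by apply/eqP=> E; move: x0; rewrite E bS' // => /set1_neq0.
- apply: contraNneq WT => E; rewrite -subTset; apply/subsetP=> x _.
  have h y : y != s' -> y \in W k.
    by move=> ys'; move/setP/(_ y): E; rewrite !inE ys'.
  by have [->|/h//] := eqVneq x s'; apply/VW'/h.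
Qed.

(** The caps are disjoint and incompatible, which produces an element [r] over exactly [u] and [v].
    It forces [u] and [v] to occur together in every side and below every element outside the caps,
    so the caps can be collapsed to one point. *)
Let diff_min u v S S' : u != v -> boundary u = set0 -> boundary v = set0 ->
  U = u |: S -> V = v |: S' -> #|S| <= 1 -> #|S'| <= 1 ->
  (forall x, x \in S -> boundary x = [set u]) ->
  (forall x, x \in S' -> boundary x = [set v]) -> False.
Proof.
move=> uv u0 v0 EU EV S1 S'1 bS bS'.
have uU : u \in U by rewrite EU setU11.
have vV : v \in V by rewrite EV setU11.
have inU x : x \in U -> x = u \/ boundary x = [set u].
  by rewrite EU => /setU1P[->|/bS]; [left|right].
have inV x : x \in V -> x = v \/ boundary x = [set v].
  by rewrite EV => /setU1P[->|/bS']; [left|right].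
have dUV : [disjoint U & V].
  apply/pred0P=> x /=; apply/negP=> /andP[/inU xU /inV xV].
  case: xU xV => [->|xu] [xv|xv].
  - by rewrite xv eqxx in uv.
  - by move: u0; rewrite xv => /set1_neq0.
  - by move: v0; rewrite -xv xu => /set1_neq0.
  - by move/set1_inj: (etrans (esym xu) xv) => E; rewrite E eqxx in uv.
(* As [U :|: V] is not filled, it contains a boundary that it cannot fill. This consists of minimal
   elements, so lies in [[set u; v]], and it needs both since each cap is filled by itself. *)
have [r rUV] : exists r, boundary r = [set u; v].
  have : ~~ filled (U :|: V).
    by apply: contra UV => h; apply/tubing2P; split=> //; constructor 3.
  rewrite negb_forall => /existsP[r]; rewrite negb_imply negbK => /andP[rUV /eqP no].
  have no' y : y \in U :|: V -> boundary y = boundary r -> False.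
    move=> yUV yr; move/setP/(_ y): no.
    by rewrite in_set0 in_setI yUV inE yr eqxx.
  have sub : boundary r \subset [set u; v].
    apply/subsetP=> z zr; have z0 := boundary_min zr.
    have /setUP[/inU|/inV] := subsetP rUV z zr; rewrite z0 => -[->|/esym/set1_neq0//];
      by rewrite !inE eqxx ?orbT.
  have [tUf _ tVf] := And3 (tube_filled_lower tU.1) I (tube_filled_lower tV.1).
  exists r; apply/eqP; rewrite eqEsubset sub /=; apply/subsetP=> z.
  have [ur|ur] := boolP (u \in boundary r); last first.
    have rV : boundary r \subset V.
      apply/subsetP=> y yr; have /set2P[E|->//] := subsetP sub y yr.
      by rewrite -E yr in ur.
    have [_ _ /(_ r)[|//|y yV /no' h]] := filled_lowerP _ _ _ tVf; first by rewrite inE.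
    by case: h; rewrite inE yV orbT.
  have [vr|vr] := boolP (v \in boundary r); last first.
    have rU : boundary r \subset U.
      apply/subsetP=> y yr; have /set2P[->//|E] := subsetP sub y yr.
      by rewrite -E yr in vr.
    have [_ _ /(_ r)[|//|y yU /no' h]] := filled_lowerP _ _ _ tUf; first by rewrite inE.
    by case: h; rewrite inE yU.
  by case/set2P=> ->.
(* If [W k] contains [d] but not the cap around [c], the cap and [W k] have a filled union. Its
   filler for the boundary of [r] cannot lie in the cap, so lies in [W k], together with [c]. *)
have both_uv k : (u \in W k) = (v \in W k).
  have [/tube_filled_lower fW _] := tW k.
  have aux C c d : (forall l, tubing [set C; W l]) -> ~~ (W k \subset C) ->
      c \in C -> boundary r = [set c; d] -> (forall x, x \in C -> d \notin boundary x) ->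
      d \in W k -> c \in W k.
    move=> CW WC cC rcd Cd dW.
    have /orP[/subsetP->//|/andP[_ /filledP/(_ r)]] := cap_or (CW k) WC.
    case.
      by apply/subsetP=> z; rewrite rcd => /set2P[]->; rewrite inE ?cC ?dW ?orbT.
    move=> y /setUP[yC|yW] yr; first by have := Cd y yC; rewrite yr rcd !inE eqxx orbT.
    have [_ Wl _] := filled_lowerP _ _ _ fW.
    by apply: (subsetP (Wl y yW)); rewrite yr rcd !inE eqxx.
  apply/idP/idP.
    apply: (aux V v u) => //; first by rewrite rUV setUC.
    by move=> x /inV[->|->]; rewrite ?v0 inE // (negPf uv).
  apply: (aux U u v) => // x /inU[->|->]; rewrite ?u0 inE // eq_sym (negPf uv) //.
have tube_uv A : tube A -> A != setT -> A != U -> A != V -> (u \in A) = (v \in A).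
  by move=> tA AT AU AV; case: (tubes_UVW tA AT) => [E|E|[k ->]] //;
    [rewrite E eqxx in AU|rewrite E eqxx in AV].
(* When [E] is the nonempty boundary of some [x], [cl E] is a tube: [x] joins the elements of [E],
   and everything else lies above some of them. *)
pose cl (E : {set P}) := E :|: [set x | (boundary x != set0) && (boundary x \subset E)].
have cl_tube E x : boundary x = E -> E != set0 -> tube (cl E).
  move=> xE E0; have Em z : z \in E -> boundary z = set0 by rewrite -xE => /boundary_min.
  have clE y : boundary y \subset cl E -> boundary y \subset E.
    move=> /subsetP yc; apply/subsetP=> z zy; have := yc z zy.
    by rewrite in_setU inE (boundary_min zy) eqxx orbF.
  have cll : lower_set (cl E).
    apply/lower_setP=> y z yc; rewrite le_eqVlt => /orP[/eqP->//|]; rewrite -in_boundary => zy.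
    move: yc => /setUP[/Em y0|]; first by move: zy; rewrite y0 inE.
    by rewrite inE => /andP[_ /subsetP/(_ z zy)]; rewrite inE => ->.
  have [e eE] := set0Pn _ E0.
  apply/and3P; split=> //.
    apply/filledP=> y /clE yE; have [y0|y0] := eqVneq (boundary y) set0.
      by exists e; rewrite ?y0 ?Em // inE eE.
    by exists y => //; rewrite !inE y0 yE orbT.
  have xcl : x \in cl E by rewrite !inE xE E0 subxx orbT.
  apply: (@connected_root _ _ _ x) => y /setUP[yE|].
    by rewrite connect_adjC connect_lower // ltW // -in_boundary xE.
  rewrite inE => /andP[y0 yE]; have [z zy] := set0Pn _ y0.
  have ycl : y \in cl E by rewrite !inE y0 yE orbT.
  apply: (@connect_trans _ _ z).
    by rewrite connect_adjC connect_lower // ltW // -in_boundary xE (subsetP yE).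
  by rewrite connect_lower // ltW // -in_boundary.
have cl_min E x z : boundary x = E -> z \in cl E -> boundary z = set0 -> z \in E.
  by move=> xE + z0; rewrite in_setU inE z0 eqxx orbF.
(* If [boundary x] contains exactly one of [u] and [v], then so does the proper tube
   [cl (boundary x)], which must therefore be a cap, and it contains [x]. *)
have bound_uv x : (u \in boundary x) = (v \in boundary x) \/ x \in U :|: V.
  have aux a b : boundary a = set0 -> boundary b = set0 ->
      ((tube (cl (boundary x)) -> cl (boundary x) != setT ->
       cl (boundary x) != U -> cl (boundary x) != V ->
       (a \in cl (boundary x)) = (b \in cl (boundary x)))) ->
      a \in boundary x -> b \notin boundary x ->
      x \in U :|: V.
    move=> a0 b0 ab ax bx; have x0 : boundary x != set0 by apply/set0Pn; exists a.
    have tc := cl_tube _ x erefl x0.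
    have xc : x \in cl (boundary x) by rewrite !inE x0 subxx orbT.
    have acl : a \in cl (boundary x) by rewrite inE ax.
    have bcl : b \notin cl (boundary x) by apply: contra bx => /cl_min; apply.
    have cT : cl (boundary x) != setT by apply: contraNneq bcl => ->; rewrite inE.
    rewrite inE; have [<-|cU] := eqVneq (cl (boundary x)) U; first by rewrite xc.
    have [<-|cV] := eqVneq (cl (boundary x)) V; first by rewrite xc orbT.
    by move: bcl; rewrite -ab ?acl.
  have [ux|ux] := boolP (u \in boundary x); have [vx|vx] := boolP (v \in boundary x);
    [by left| | |by left]; right.
  - by apply: (aux u v) => // *; apply: tube_uv.
  - by apply: (aux v u) => // *; apply/esym/tube_uv.
(* [u] stands for both [u] and [v]; [phi] undoes the identification. *)
pose Y := u |: ~: (U :|: V); pose D x := boundary x :\ v.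
have vY : v \notin Y by rewrite !inE eq_sym (negPf uv) vV orbT.
have YP x : x \in Y -> x = u \/ x \notin U :|: V.
  by move=> /setU1P[->|]; [left|rewrite inE; right].
have Yuv x : x \in Y -> (u \in boundary x) = (v \in boundary x).
  case/YP=> [->|xUV]; first by rewrite u0 !inE.
  by case: (bound_uv x) => // h; rewrite h in xUV.
have minY z : boundary z = set0 -> z != v -> z \in Y.
  move=> z0 zv; rewrite !inE; case: eqVneq => //= zu.
  by apply/norP; split; apply/negP; [move/inU|move/inV];
    rewrite z0 => -[E|/esym/set1_neq0//]; [rewrite E eqxx in zu|rewrite E eqxx in zv].
have uY : u \in Y by rewrite setU11.
have Du x : (u \in D x) = (u \in boundary x) by rewrite !inE uv.
(* Dropping [v] from boundaries loses nothing on [Y], where it accompanies [u]. *)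
have D_inj x y : x \in Y -> y \in Y -> D x = D y -> boundary x = boundary y.
  move=> xY yY E; apply/setP=> z; have [->|zv] := eqVneq z v.
    by rewrite -!Yuv // -!Du E.
  by move/setP/(_ z): E; rewrite !in_setD1 zv.
pose phi (G : {set P}) := if u \in G then G :|: U :|: V else G.
have GYn (G : {set P}) x : x \in Y -> x \notin G -> x \notin phi G :|: V.
  move=> xY xG; rewrite in_setU negb_or; apply/andP; split.
    rewrite /phi; case: ifP => // uG; rewrite !in_setU (negPf xG) /=.
    by case/YP: xY => [E|]; [rewrite E uG in xG|rewrite in_setU].
  by case/YP: xY => [->|]; [rewrite (disjointFr dUV uU)|rewrite in_setU negb_or => /andP[]].
have Gphi (G : {set P}) : G \subset phi G.
  by rewrite /phi; case: ifP => // _; rewrite -setUA subsetUl.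
have inphi (G : {set P}) x : x \in phi G -> x \in G \/ u \in G /\ x \in U :|: V.
  by rewrite /phi; case: ifP => [uG|_]; [rewrite -setUA => /setUP[]; [left|right]|left].
have UVphi (G : {set P}) x : u \in G -> x \in U :|: V -> x \in phi G.
  by rewrite /phi => -> xUV; rewrite -setUA in_setU xUV orbT.
have phiS (G G' : {set P}) : G \subset G' -> phi G \subset phi G'.
  move=> GG'; apply/subsetP=> x /inphi[xG|[uG xUV]].
    by apply: (subsetP (Gphi G')); apply: (subsetP GG').
  by apply: UVphi => //; apply: (subsetP GG').
(* [V] is added so that every [phi G :|: V] lies above [V], which will head a chain of four. *)
have fphi G : filled_lower Y D G -> G != set0 -> fill (phi G :|: V).
  move=> /filled_lowerP[GY Gl Gf] G0.
  have Guv x : x \in G -> v \in boundary x -> u \in G.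
    move=> xG vx; apply: (subsetP (Gl x xG)).
    by rewrite Du Yuv // (subsetP GY).
  have [g gG g0] : exists2 g, g \in G & boundary g = set0.
    have [x xG] := set0Pn _ G0; have [Dx|[z zD]] := set_0Vmem (D x).
      exists x => //; apply/setP=> z; rewrite in_set0; apply/negP=> zx.
      have [zv|zv] := eqVneq z v; last first.
        by move/setP/(_ z): Dx; rewrite !inE zv -in_boundary zx.
      move/setP/(_ u): Dx; rewrite Du in_set0 Yuv -?zv ?zx //.
      exact: (subsetP GY).
    exists z; first exact: (subsetP (Gl x xG)).
    by apply: (@boundary_min x); case/setD1P: zD.
  apply/filled_lowerP; split=> // x.
    have UVb : x \in U :|: V -> boundary x \subset U :|: V.
      by case/setUP=> [/inU|/inV] [->|->]; rewrite ?u0 ?v0 ?sub0set // sub1set inE ?uU ?vV ?orbT.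
    case/setUP=> [/inphi[xG|[uG xUV]]|xV]; apply/subsetP=> y yx.
    - have [E|yv] := eqVneq y v; first by rewrite E in_setU vV orbT.
      by rewrite in_setU (subsetP (Gphi G)) // (subsetP (Gl x xG)) // in_setD1 yv.
    - by rewrite in_setU UVphi // (subsetP (UVb xUV)).
    - have /inV[E|E] := xV; first by rewrite E v0 inE in yx.
      by move: yx; rewrite E => /set1P->; rewrite in_setU vV orbT.
  move=> _ xH; have [x0|x0] := eqVneq (boundary x) set0.
    by exists g; rewrite ?x0 // in_setU (subsetP (Gphi G)).
  have Hmin z : boundary z = set0 -> z \in phi G :|: V -> z != v -> z \in G.
    move=> z0 zH zv; apply: contraTT zH => zG; apply: GYn => //; exact: minY.
  have [xUV|xUV] := boolP (x \in U :|: V).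
    exists x => //; case/setUP: xUV => [xU|xV]; last by rewrite in_setU xV orbT.
    rewrite in_setU UVphi //; last by rewrite inE xU.
    have /inU[E|E] := xU; first by rewrite E u0 eqxx in x0.
    by apply: Hmin => //; apply: (subsetP xH); rewrite E inE.
  have xY : x \in Y by rewrite in_setU1 in_setC xUV orbT.
  have [|y yG yx] := Gf x xY.
    apply/subsetP=> z /setD1P[zv zx]; apply: Hmin => //; first exact: boundary_min zx.
    exact: (subsetP xH).
  exists y; first by rewrite in_setU (subsetP (Gphi G)).
  by apply: D_inj => //; apply: (subsetP GY).
have few : #|[set F | [&& filled_lower Y D F, F != set0 & F != Y]]| <= 6.
  apply: card_filled_lower.
  - move=> x _; apply/subsetP=> z /setD1P[zv zx]; apply: minY => //; exact: boundary_min zx.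
  - by move=> x y _ /setD1P[_ /boundary_min yx]; rewrite /D yx set0D.
  - move=> F1 F2 F3 f1 f2 f3 F10 F12 F23 F3Y.
    have F20 : F2 != set0 by case/properP: F12 => _ [x xF _]; apply/set0Pn; exists x.
    have F30 : F3 != set0 by case/properP: F23 => _ [x xF _]; apply/set0Pn; exists x.
    have strict (G G' : {set P}) : G \proper G' -> G' \subset Y -> phi G :|: V \proper phi G' :|: V.
      case/properP=> GG' [x xG' xG] G'Y; apply/properP; split; first by rewrite setSU ?phiS.
      exists x; first by rewrite in_setU (subsetP (Gphi G')).
      by apply: GYn => //; apply: (subsetP G'Y).
    have F3sY := proper_sub F3Y; have F2sY := subset_trans (proper_sub F23) F3sY.
    have F1sY := subset_trans (proper_sub F12) F2sY.
    apply: (@no_chain4 V (phi F1 :|: V) (phi F2 :|: V) (phi F3 :|: V)).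
    + exact: tube_filled_lower tV.1.
    + exact: fphi.
    + exact: fphi.
    + exact: fphi.
    + by apply/set0Pn; exists v.
    + have [x xF] := set0Pn _ F10; apply/properP; split; first exact: subsetUr.
      exists x; first by rewrite in_setU (subsetP (Gphi F1)).
      have := subsetP F1sY x xF => /YP[->|]; first by rewrite (disjointFr dUV uU).
      by rewrite in_setU negb_or => /andP[].
    + exact: strict.
    + exact: strict.
    + case/properP: F3Y => _ [x xY xF]; apply: contraNneq (GYn _ _ xY xF) => ->.
      by rewrite in_setT.
(* A side that meets a cap contains it, and [both_uv] links the two caps; so a side contains all or
   nothing of [U :|: V]. *)
have WUV k x : x \in U :|: V -> (x \in W k) = (u \in W k).
  move=> xUV; apply/idP/idP => [xW|uW].
    case/setUP: xUV => [xU|xV].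
      exact: (subsetP (cap_sub (UW k) (noWU k) xU xW)).
    by rewrite both_uv; apply: (subsetP (cap_sub (VW k) (noWV k) xV xW)).
  have vW : v \in W k by rewrite -both_uv.
  case/setUP: xUV => [xU|xV].
    exact: (subsetP (cap_sub (UW k) (noWU k) uU uW)).
  exact: (subsetP (cap_sub (VW k) (noWV k) vV vW)).
have nY x : x \notin Y -> x \in U :|: V.
  by rewrite in_setU1 negb_or in_setC negbK => /andP[].
apply: (eight (g := fun k => W k :&: Y) _ _ few) => [k l E|k].
  have h x : x \in Y -> (x \in W k) = (x \in W l).
    by move=> xY; move/setP/(_ x): E; rewrite !in_setI xY !andbT.
  apply: W_inj; apply/setP=> x; have [/h//|/nY xUV] := boolP (x \in Y).
  by rewrite !WUV // h.
have [/tube_filled_lower fW WT] := tW k; have [_ Wl Wf] := filled_lowerP _ _ _ fW.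
split.
- apply/filled_lowerP; split; first exact: subsetIr.
    move=> x /setIP[xW xY]; apply/subsetP=> z /setD1P[zv zx].
    rewrite in_setI (subsetP (Wl x xW)) //=; apply: minY => //; exact: boundary_min zx.
  move=> x xY xW; have xW' : boundary x \subset W k.
    apply/subsetP=> z zx; have [zv|zv] := eqVneq z v; last first.
      have : z \in D x by rewrite in_setD1 zv.
      by move/(subsetP xW)/setIP=> [].
    rewrite zv -both_uv; have : u \in D x by rewrite Du Yuv // -zv.
    by move/(subsetP xW)/setIP=> [].
  have [|y yW yx] := Wf x _ xW'; first by rewrite inE.
  have [yY|/nY yUV] := boolP (y \in Y); first by exists y; rewrite ?in_setI ?yW // /D yx.
  have [x0|x0] := eqVneq (boundary x) set0.
    exists u; first by rewrite in_setI -(WUV k y yUV) yW.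
    by rewrite /D x0 u0.
  have xu : x != u by apply: contraNneq x0 => ->; rewrite u0.
  (* A filler [y] in a cap would give [x] the boundary [[set u]] or [[set v]], and then [bound_uv]
     would put [x] in a cap too. *)
  have xUV : x \in U :|: V; last by move: xY; rewrite in_setU1 (negPf xu) in_setC xUV.
  case/setUP: yUV => [/inU|/inV] [E|E].
  + by rewrite -yx E u0 eqxx in x0.
  + by case: (bound_uv x) => //; rewrite -yx E !inE eqxx eq_sym (negPf uv).
  + by rewrite -yx E v0 eqxx in x0.
  + by case: (bound_uv x) => //; rewrite -yx E !inE eqxx (negPf uv).
- have [x xW x0] := filled_lower_min fW (W0 k); apply/set0Pn.
  have [xv|xv] := eqVneq x v.
    by exists u; rewrite in_setI uY andbT both_uv -xv.
  by exists x; rewrite in_setI xW minY.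
- apply: contraNneq WT => E; rewrite -subTset; apply/subsetP=> x _.
  have h y : y \in Y -> y \in W k by rewrite -E => /setIP[].
  by have [/h//|/nY xUV] := boolP (x \in Y); rewrite WUV // h.
Qed.

Lemma suspended_octagon_false : False.
Proof.
have [u [S [u0 EU S1 bS]]] := minimal_tube tU.1 (nonempty tU.1 tU.2) Umin.
have [v [S' [v0 EV S'1 bS']]] := minimal_tube tV.1 (nonempty tV.1 tV.2) Vmin.
have [uv|uv] := eqVneq u v; last exact: (diff_min uv u0 v0 EU EV).
by move: EV bS'; rewrite -uv => EV bS'; apply: (same_min u0 EU EV).
Qed.

End HeightTwo.

(** * The seven-element poset *)

(** Each list contains all strictly smaller elements, not only those covered. *)
Definition below (x : nat) : seq nat := nth [::]
  [:: [::]; [::]; [:: 0]; [:: 0; 1]; [:: 0; 1]; [:: 0; 1; 2]; [:: 0; 1; 2]] x.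

(** An alias, so that the new order does not clash with the natural order on ['I_7]. *)
Definition P7 := 'I_7.
HB.instance Definition _ := Finite.on P7.

Definition P7_lt (x y : P7) : bool := (x : nat) \in below y.
Definition P7_le (x y : P7) : bool := (x == y) || P7_lt x y.

(* Quantification over ['I_n] does not compute, so finite checks are stated on
   [iota 0 n] and settled by [vm_compute]. *)
Lemma all_iotaP n (p : pred nat) : all p (iota 0 n) -> forall i : 'I_n, p i.
Proof. by move=> /allP h i; apply: h; rewrite mem_iota add0n ltn_ord. Qed.

Lemma all_iota2P n m (p : nat -> pred nat) :
  all (fun i => all (p i) (iota 0 m)) (iota 0 n) -> forall (i : 'I_n) (j : 'I_m), p i j.
Proof. by move=> h i; apply: all_iotaP; apply: (all_iotaP h). Qed.

Lemma P7_lt_def (x y : P7) : P7_lt x y = (y != x) && P7_le x y.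
Proof.
rewrite /P7_le /P7_lt -!val_eqE; apply/eqP.
by apply: (@all_iota2P 7 7 (fun x y => (x \in below y) ==
  (y != x) && ((x == y) || (x \in below y)))).
Qed.

Lemma P7_le_refl : reflexive P7_le.
Proof. by move=> x; rewrite /P7_le eqxx. Qed.

Lemma P7_le_anti : antisymmetric P7_le.
Proof.
move=> x y; rewrite /P7_le /P7_lt -!val_eqE => h; apply/val_inj/eqP.
move: h; apply/implyP.
by apply: (@all_iota2P 7 7 (fun x y => ((x == y) || (x \in below y)) &&
  ((y == x) || (y \in below x)) ==> (x == y))).
Qed.

Lemma P7_le_trans : transitive P7_le.
Proof.
move=> y x z; rewrite /P7_le /P7_lt -!val_eqE => h1 h2.
have h : all (fun i => all (fun j => all (fun k => 
  ((i == j) || (i \in below j)) ==> ((j == k) || (j \in below k)) ==>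
  ((i == k) || (i \in below k))) (iota 0 7)) (iota 0 7)) (iota 0 7) by vm_compute.
have /implyP/(_ h1)/implyP/(_ h2) := all_iotaP (all_iotaP (all_iotaP h x) y) z.
by [].
Qed.

Fact P7_display : Order.disp_t. Proof. exact: Order.Disp tt tt. Qed.

HB.instance Definition _ := Order.isPOrder.Build P7_display P7
  P7_lt_def P7_le_refl P7_le_anti P7_le_trans.

Definition P7_poset : finPOrderType P7_display := P7.

(* Entries 0 to 7 are the sides, each nested with the two cyclically adjacent
   ones; entries 8 and 9 are the caps. *)
Definition tube_list : seq (seq nat) :=
  [:: [:: 0; 1; 2; 3; 5]; [:: 0; 1; 2; 3; 4; 5]; [:: 0; 1; 2; 4; 5]; [:: 0; 1; 2; 4; 5; 6];
      [:: 0; 1; 2; 4; 6]; [:: 0; 1; 2; 3; 4; 6]; [:: 0; 1; 2; 3; 6]; [:: 0; 1; 2; 3; 5; 6];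
      [:: 1]; [:: 0; 2]].

Definition tube_elts (i : nat) : seq nat := nth [::] tube_list i.

Definition tube_of (i : 'I_10) : {set P7} := [set x : P7 | (x : nat) \in tube_elts i].

(* Vertex [j] of the prism lies on the sides [j] and [j + 1] modulo 8, and on
   cap 8 for [j < 8], cap 9 for [8 <= j]. *)
Definition facets_at (j : nat) : seq nat := [:: j %% 8; (j + 1) %% 8; 8 + j %/ 8].

(** Subsets become bit masks of [iota 0 n], so that checks over all subsets compute. *)
Fixpoint bits n : seq bitseq :=
  if n is n'.+1 then [seq b :: m | b <- [:: true; false], m <- bits n'] else [:: [::]].

Lemma mem_bits m : m \in bits (size m).
Proof.
elim: m => // b m IH /=; rewrite !mem_cat; case: b; rewrite map_f ?orbT //.
Qed.

Lemma set_ord_mask n (L : {set 'I_n}) :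
  exists2 m, m \in bits n & forall i : 'I_n, (i \in L) = ((i : nat) \in mask m (iota 0 n)).
Proof.
exists [seq i \in L | i <- enum 'I_n].
  set m := map _ _; suff <- : size m = n by apply: mem_bits.
  by rewrite size_map size_enum_ord.
move=> i; rewrite -val_enum_ord -map_mask -filter_mask mem_map; last exact: val_inj.
by rewrite mem_filter mem_enum andbT.
Qed.

Lemma P7_boundary (x : P7_poset) y : (y \in boundary x) = ((y : nat) \in below x).
Proof. by rewrite inE. Qed.

Lemma P7_boundary_inj (x y : P7_poset) :
  boundary x = boundary y -> below x = below y.
Proof.
move=> /setP xy; apply/eqP.
have : all (fun x => all (fun y => all (fun z => (z \in below x) == (z \in below y))
  (iota 0 7) ==> (below x == below y)) (iota 0 7)) (iota 0 7) by vm_compute.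
move=> /(@all_iota2P 7 7 (fun x y => _))/(_ x y)/implyP; apply.
apply/allP=> z; rewrite mem_iota add0n => /andP[_ z7].
by have := xy (Ordinal z7); rewrite !P7_boundary => ->.
Qed.

Lemma below_lt (x : 'I_7) y : y \in below x -> y < 7.
Proof.
have : all (fun x => all (fun y => y < 7) (below x)) (iota 0 7) by vm_compute.
by move/(@all_iotaP 7)/(_ x)/allP; apply.
Qed.

Lemma tube_lt (i : 'I_10) x : x \in tube_elts i -> x < 7.
Proof.
have : all (fun i => all (fun y => y < 7) (tube_elts i)) (iota 0 10) by vm_compute.
by move/(@all_iotaP 10)/(_ i)/allP; apply.
Qed.

(** A run through the 128 subsets finds that the proper filled lower sets are all in [tube_list]. *)
Lemma P7_tube_of (L : {set P7_poset}) : tube L -> L != setT -> exists i, L = tube_of i.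
Proof.
move=> /and3P[/lower_setP Ll /filledP Lf _] LT.
have [m mb mE] := set_ord_mask L.
set s := mask m (iota 0 7) in mE.
have low : all (fun x => (x \in s) ==> all (mem s) (below x)) (iota 0 7).
  apply/allP=> x; rewrite mem_iota add0n => /andP[_ x7].
  have := Ll (Ordinal x7); rewrite mE /= => h.
  apply/implyP=> xs; apply/allP=> y yx.
  have y7 : y < 7 := @below_lt (Ordinal x7) y yx.
  have := h (Ordinal y7) xs; rewrite mE; apply.
  by apply: ltW; rewrite -in_boundary P7_boundary.
have fil : all (fun x => all (mem s) (below x) ==>
    has (fun y => below y == below x) s) (iota 0 7).
  apply/allP=> x; rewrite mem_iota add0n => /andP[_ x7].
  apply/implyP=> /allP xs.
  have [|y] := Lf (Ordinal x7).
    by apply/subsetP=> y; rewrite P7_boundary /= mE => /xs.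
  rewrite mE => ys /P7_boundary_inj yx; apply/hasP; exists (y : nat) => //; exact/eqP.
have sT : s != iota 0 7.
  apply: contraNneq LT => E; apply/eqP/setP=> x.
  by rewrite mE E mem_iota add0n inE; have := ltn_ord x.
have : all (fun m => let s := mask m (iota 0 7) in
   all (fun x => (x \in s) ==> all (mem s) (below x)) (iota 0 7) ==>
   all (fun x => all (mem s) (below x) ==>
    has (fun y => below y == below x) s) (iota 0 7) ==>
   (s != iota 0 7) ==> (s \in tube_list)) (bits 7) by vm_compute.
move=> /allP/(_ m mb)/=; rewrite -/s => /implyP/(_ low)/implyP/(_ fil)/implyP/(_ sT).
move=> /(nthP [::])[i i10 si]; exists (Ordinal (i10 : i < 10)).
by apply/setP=> x; rewrite mE -si inE.
Qed.

Lemma tube_of_tube (i : 'I_10) : tube (tube_of i : {set P7_poset}) && (tube_of i != setT).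
Proof.
have tl : lower_set (tube_of i : {set P7_poset}).
  apply/lower_setP=> x y xi; rewrite le_eqVlt => /orP[/eqP->//|].
  rewrite -in_boundary P7_boundary !inE in xi * => yx.
  have : all (fun i => all (fun x => all (fun y =>
      (x \in tube_elts i) ==> (y \in below x) ==> (y \in tube_elts i))
    (iota 0 7)) (iota 0 7)) (iota 0 10) by vm_compute.
  by move=> /(@all_iota2P 10 7 (fun i x => _))/(_ i x)/all_iotaP/(_ y)/implyP/(_ xi)/implyP; apply.
rewrite /tube tl /=; apply/andP; split; last first.
  have : all (fun i => has (fun x => x \notin tube_elts i) (iota 0 7)) (iota 0 10).
    by vm_compute.
  move=> /(@all_iotaP 10 (fun i => _))/(_ i)/hasP[x]; rewrite mem_iota add0n => /andP[_ x7] xi.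
  by apply/eqP=> /setP/(_ (Ordinal x7)); rewrite !inE (negPf xi).
apply/andP; split.
  apply/filledP=> x /subsetP xi.
  have : all (fun i => all (fun x => all (fun y => y \in tube_elts i) (below x) ==>
      has (fun y => (y \in tube_elts i) && (below y == below x)) (iota 0 7))
    (iota 0 7)) (iota 0 10) by vm_compute.
  move=> /(@all_iota2P 10 7 (fun i x => _))/(_ i x)/implyP h.
  have /hasP[y] : has (fun y => (y \in tube_elts i) && (below y == below x)) (iota 0 7).
    apply: h; apply/allP=> y yx.
    have y7 := below_lt yx.
    by have := xi (Ordinal y7); rewrite P7_boundary inE; apply.
  rewrite mem_iota add0n => /andP[_ y7] /andP[yi /eqP yx].
  exists (Ordinal y7); first by rewrite inE.
  by apply/setP=> z; rewrite !P7_boundary /= yx.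
(* Some [c] in each tube has a common upper bound inside the tube with every
   element of it. *)
have : all (fun i => has (fun c => (c \in tube_elts i) &&
    all (fun x => (x \in tube_elts i) ==> has (fun t => [&& t \in tube_elts i,
        (c == t) || (c \in below t) & (x == t) || (x \in below t)]) (iota 0 7))
      (iota 0 7)) (iota 0 7)) (iota 0 10) by vm_compute.
move=> /(@all_iotaP 10 (fun i => _))/(_ i)/hasP[c]; rewrite mem_iota add0n => /andP[_ c7].
move=> /andP[ci /(@all_iotaP 7 (fun i => _)) h].
apply: (@connected_root _ _ _ (Ordinal c7 : P7_poset)) => x; rewrite inE => xi.
have /implyP/(_ xi)/hasP[t] := h x; rewrite mem_iota add0n => /andP[_ t7] /and3P[ti ct xt].
have tL : (Ordinal t7 : P7_poset) \in (tube_of i : {set P7_poset}) by rewrite inE.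
apply: (@connect_trans _ _ (Ordinal t7 : P7_poset)); first by apply: connect_lower.
by rewrite connect_adjC; apply: connect_lower.
Qed.

Lemma tube_of_inj : injective tube_of.
Proof.
move=> i j /setP ij; apply/val_inj/eqP.
have : all (fun i => all (fun j =>
    all (fun x => (x \in tube_elts i) == (x \in tube_elts j)) (iota 0 7) ==> (i == j))
  (iota 0 10)) (iota 0 10) by vm_compute.
move=> /(@all_iota2P 10 10 (fun i x => _))/(_ i j)/implyP; apply.
apply/allP=> x; rewrite mem_iota add0n => /andP[_ x7].
by have := ij (Ordinal x7); rewrite !inE => ->.
Qed.

Definition facet_set (j : 'I_16) : {set 'I_10} := [set i : 'I_10 | (i : nat) \in facets_at j].

(** Compatible tubes turn out to be nested, so tubings are nested families; a run through the 1024
    families shows that each lies among the three facets at some vertex of the prism. *)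
Lemma P7_tubing (T : {set {set P7_poset}}) :
  tubing T <-> exists2 S : {set 'I_10}, T = tube_of @: S & exists j, S \subset facet_set j.
Proof.
pose nested a b := all (fun x => x \in tube_elts b) (tube_elts a).
have nestP i j : reflect (tube_of i \subset tube_of j) (nested i j).
  apply: (iffP allP) => [h|/subsetP h x xi].
    by apply/subsetP=> x; rewrite !inE => /h.
  have x7 := tube_lt xi.
  by have := h (Ordinal x7); rewrite !inE; apply.
split=> [tT|[S -> [j Sj]]].
  have /tubingP[hT hN hF] := tT.
  exists [set i | tube_of i \in T].
    apply/setP=> A; apply/idP/imsetP => [AT|[i]]; last by rewrite inE => iT ->.
    by have [i Ai] := P7_tube_of (hT A AT).1 (hT A AT).2; exists i; rewrite // inE -Ai.
  set S := [set i | _]; have nS i j : i \in S -> j \in S -> nested i j || nested j i.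
    rewrite !inE => iT jT.
    have := tubingS (_ : [set tube_of i; tube_of j] \subset T) tT.
    rewrite subUset !sub1set iT jT => /(_ isT)/tubing2P[_ _ []].
    - by move=> /nestP->.
    - by move=> /nestP->; rewrite orbT.
    - move=> [dij fij]; exfalso; move: dij fij => dij /filledP fij.
      (* Two tubes either meet or have an unfilled union. *)
      have : all (fun i => all (fun j => has (mem (tube_elts j)) (tube_elts i) ||
          has (fun x =>
            all (fun z => (z \in tube_elts i) || (z \in tube_elts j)) (below x) &&
            all (fun y => ((y \in tube_elts i) || (y \in tube_elts j)) ==>
              (below y != below x)) (iota 0 7)) (iota 0 7))
        (iota 0 10)) (iota 0 10) by vm_compute.
      move=> /(@all_iota2P 10 10 (fun i j => _))/(_ i j)/orP[/hasP[x xi xj]|/hasP[x]].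
        have x7 := tube_lt xi.
        by have /pred0P/(_ (Ordinal x7)) := dij; rewrite /= !inE xi => /negP.
      rewrite mem_iota add0n => /andP[_ x7] /andP[/allP xij /(@all_iotaP 7) no].
      have [|y yij yx] := fij (Ordinal x7).
        by apply/subsetP=> z; rewrite P7_boundary => /xij; rewrite !inE.
      have := no y; rewrite !inE in yij; rewrite yij /= => /negP; apply; apply/eqP.
      exact: (P7_boundary_inj (y := Ordinal x7)).
  have [m mb mE] := set_ord_mask S.
  have : all (fun m => let s := mask m (iota 0 10) in
    all (fun a => all (fun b => nested a b || nested b a) s) s ==>
    has (fun j => all (fun i => i \in facets_at j) s) (iota 0 16)) (bits 10) by vm_compute.
  move=> /allP/(_ m mb)/implyP h.
  have /hasP[j] : has (fun j => all (fun i => i \in facets_at j) (mask m (iota 0 10))) (iota 0 16).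
    apply: h; apply/allP=> a am; apply/allP=> b bm.
    have [a10 b10] : a < 10 /\ b < 10.
      by move: (mem_mask am) (mem_mask bm); rewrite !mem_iota.
    by apply: (nS (Ordinal a10) (Ordinal b10)); rewrite mE.
  rewrite mem_iota add0n => /andP[_ j16] /allP jm; exists (Ordinal j16).
  by apply/subsetP=> i; rewrite mE => /jm ij; rewrite inE.
apply: nested_tubing => [A /imsetP[i _ ->]|A B]; first by apply/andP/tube_of_tube.
move=> /imsetP[i iS ->] /imsetP[k kS ->].
have : all (fun j => all (fun i => all (fun k => (i \in facets_at j) ==> (k \in facets_at j) ==>
  (nested i k || nested k i)) (iota 0 10)) (iota 0 10)) (iota 0 16) by vm_compute.
move=> /(@all_iota2P 16 10 (fun i x => _))/(_ j i)/(@all_iotaP 10 (fun i => _))/(_ k).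
move: (subsetP Sj i iS) (subsetP Sj k kS); rewrite !inE => -> -> /=.
by case/orP=> /nestP->; rewrite ?orbT.
Qed.

From mathcomp Require Import boolp classical_sets functions reals.
From mathcomp Require Import ring.

Local Open Scope ring_scope.

(** * Faces of simple polytopes *)

Section PosetIso.
Local Open Scope classical_set_scope.
Variables (S T U : Type) (A : set S) (B : set T) (C : set U).
Variables (leA : S -> S -> Prop) (leB : T -> T -> Prop) (leC : U -> U -> Prop).

Lemma poset_iso_trans :
  poset_iso A leA B leB -> poset_iso B leB C leC -> poset_iso A leA C leC.
Proof.
move=> [f [[fA fI fS] fle]] [g [[gB gI gS] gle]].
exists (g \o f); split.
  split.
  - by move=> x Ax; apply: gB; apply: fA.
  - move=> x y; rewrite !inE => Ax Ay /= /gI; rewrite !inE => /(_ (fA _ Ax) (fA _ Ay)).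
    by apply: fI; rewrite inE.
  - move=> z /gS[y By <-]; have [x Ax <-] := fS y By.
    by exists x.
by move=> x y Ax Ay; rewrite fle //=; apply: gle; apply: fA.
Qed.

(** [s0] is the value of the inverse outside [B]. *)
Lemma poset_iso_sym (s0 : S) :
  poset_iso A leA B leB -> poset_iso B leB A leA.
Proof.
move=> [f [[fA fI fS] fle]].
have /choice[g gP] : forall y, exists x, B y -> A x /\ f x = y.
  move=> y; have [By|nBy] := pselect (B y); last by exists s0.
  by have [x Ax <-] := fS y By; exists x.
exists g; split.
  split.
  - by move=> y /gP[].
  - move=> y z; rewrite !inE => /gP[_ fy] /gP[_ fz] E.
    by rewrite -fy -fz E.
  - move=> x Ax; exists (f x); first exact: fA.
    have [Ag fg] := gP _ (fA _ Ax).
    by apply: fI; rewrite ?inE.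
move=> y z By Bz; have [[Ay fy] [Az fz]] := (gP _ By, gP _ Bz).
by rewrite -{1}fy -{1}fz; apply: iff_sym; apply: fle.
Qed.
End PosetIso.

(** * The face poset of a simple polytope from its vertex-facet incidences *)

Section SimplePolytope.
Local Open Scope classical_set_scope.
Variables (R : realType) (d : nat).

Definition dot (a : 'cV[R]_d) (x : 'rV[R]_d) : R := (x *m a) 0 0.

Lemma dot_is_linear a : linear_for *%R (dot a).
Proof. by move=> k x y; rewrite /dot mulmxDl -scalemxAl !mxE. Qed.

HB.instance Definition _ a := GRing.isLinear.Build R 'rV[R]_d R *%R (dot a) (dot_is_linear a).

Lemma dot_sum (I : finType) (P : pred I) (a : I -> 'cV[R]_d) x :
  dot (\sum_(i | P i) a i) x = \sum_(i | P i) dot (a i) x.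
Proof. by rewrite /dot mulmx_sumr summxE. Qed.

Lemma conv_hull_mem (s : seq 'rV[R]_d) x : x \in s -> conv_hull s x.
Proof.
move=> xs; have ks : (index x s < size s)%N by rewrite index_mem.
exists (fun i => (i == Ordinal ks)%:R); split.
- by move=> i; rewrite ler0n.
- by rewrite (bigD1 (Ordinal ks)) //= eqxx big1 ?addr0 // => i /negPf->.
- rewrite (bigD1 (Ordinal ks)) //= eqxx scale1r nth_index // big1 ?addr0 // => i /negPf->.
  by rewrite scale0r.
Qed.

Lemma conv_hull_le (s : seq 'rV[R]_d) (f : {scalar 'rV[R]_d}) b x :
  (forall y, y \in s -> f y <= b) -> conv_hull s x -> f x <= b.
Proof.
move=> sb [w [w0 w1 ->]]; rewrite linear_sum -[b]mul1r -w1 mulr_suml.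
apply: ler_sum => i _; rewrite scalarZ; apply: ler_wpM2l => //.
by apply: sb; rewrite mem_nth.
Qed.

(* A point of the hull lies on a supporting hyperplane iff every generator that
   enters it with nonzero weight does. *)
Lemma conv_hull_face (s : seq 'rV[R]_d) x : conv_hull s x ->
  exists2 p : pred 'rV[R]_d, (exists2 y, y \in s & p y) &
    forall (f : {scalar 'rV[R]_d}) b, (forall y, y \in s -> f y <= b) ->
      (f x = b <-> {in s, forall y, p y -> f y = b}).
Proof.
move=> [w [w0 w1 xE]].
exists (fun y => [exists i : 'I_(size s), (s`_i == y) && (w i != 0)]).
  have [i wi] : exists i, w i != 0.
    apply/existsP; apply: contraTT (oner_neq0 R) => /existsPn h.
    rewrite negbK -w1 big1 // => i _; apply/eqP; have := h i; by rewrite negbK.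
  by exists s`_i; [rewrite mem_nth|apply/existsP; exists i; rewrite eqxx].
move=> f b sb.
have fx : b - f x = \sum_i w i * (b - f s`_i).
  rewrite xE linear_sum -[b in LHS]mul1r -w1 mulr_suml -sumrB.
  by apply: eq_bigr => i _; rewrite scalarZ mulrBr.
have ge0 (i : 'I_(size s)) : 0 <= w i * (b - f s`_i).
  by rewrite mulr_ge0 // subr_ge0 sb // mem_nth.
split=> [fb y ys /existsP[i /andP[/eqP<- wi]]|h].
  have /psumr_eq0P/(_ i isT) : \sum_i w i * (b - f s`_i) = 0 by rewrite -fx fb subrr.
  move=> /(_ (fun i _ => ge0 i))/eqP; rewrite mulf_eq0 (negPf wi) /= subr_eq0.
  by move/eqP.
apply/esym/eqP; rewrite -subr_eq0 fx big1 // => i _; apply/eqP; rewrite mulf_eq0.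
have [//|wi] := eqVneq (w i) 0; rewrite /= subr_eq0 h ?mem_nth //.
by apply/existsP; exists i; rewrite eqxx.
Qed.

(** A certificate for a simple polytope: [inc j] lists the facets through [v j], and [nbr j i] is
    the other end of the edge that leaves facet [i] there. By [inc_free] the normals at a vertex
    span the dual space. *)
Variables (n m : nat) (v : 'I_n -> 'rV[R]_d) (a : 'I_m -> 'cV[R]_d) (b : 'I_m -> R).
Variables (inc : 'I_n -> {set 'I_m}) (nbr : 'I_n -> 'I_m -> 'I_n).

Hypothesis v_le : forall j i, dot (a i) (v j) <= b i.
Hypothesis v_eq : forall j i, (dot (a i) (v j) == b i) = (i \in inc j).
Hypothesis nbr_inc : forall j i k, i \in inc j -> k \in inc j ->
  (k \in inc (nbr j i)) = (k != i).
Hypothesis inc_free : forall j x, (forall i, i \in inc j -> dot (a i) x = 0) -> x = 0.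

Definition vertices : seq 'rV[R]_d := [seq v j | j <- enum 'I_n].
Local Notation s := vertices.
Local Notation Q := (conv_hull vertices).

Let vP y : reflect (exists j, y = v j) (y \in s).
Proof.
by apply: (iffP mapP) => [[j _ ->]|[j ->]]; exists j; rewrite ?mem_enum.
Qed.

Let s_le i y : y \in s -> dot (a i) y <= b i.
Proof. by move=> /vP[j ->]. Qed.

Let Qv j : Q (v j). Proof. by apply/conv_hull_mem/vP; exists j. Qed.

Let face_of (S : {set 'I_m}) : set 'rV[R]_d :=
  Q `&` [set x | forall i, i \in S -> dot (a i) x = b i].

Let face_of_v (S : {set 'I_m}) j : face_of S (v j) <-> S \subset inc j.
Proof.
split=> [[_ h]|/fintype.subsetP h]; first by apply/fintype.subsetP=> i /h /eqP; rewrite v_eq.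
by split=> // i /h; rewrite -v_eq => /eqP.
Qed.

(** The sum of the inequalities in [S] is tight only where each of them is. *)
Let face_of_face (S : {set 'I_m}) : face Q (face_of S).
Proof.
exists (dot (\sum_(i in S) a i)), (\sum_(i in S) b i).
have le x : Q x -> dot (\sum_(i in S) a i) x <= \sum_(i in S) b i.
  by move=> Qx; rewrite dot_sum; apply: ler_sum => i _; apply: conv_hull_le Qx; apply: s_le.
split=> //; apply/seteqP; split=> x [Qx h]; split=> //=.
  by rewrite dot_sum; apply: eq_bigr => i /h.
move=> i iS; apply/eqP; rewrite -subr_eq0 -oppr_eq0 opprB; apply/eqP.
have /psumr_eq0P : \sum_(i in S) (b i - dot (a i) x) = 0.
  by rewrite sumrB -dot_sum h subrr.
apply=> // k _; rewrite subr_ge0; apply: conv_hull_le Qx; exact: s_le.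
Qed.

(* Since the polytope is simple, it lies in the cone spanned by the edges at
   each vertex, with coefficients given by the slacks of the facets there. *)
Let edge_cone j k : exists2 c : 'I_m -> R,
  (forall i, i \in inc j -> 0 <= c i /\ (c i == 0) = (i \in inc k)) &
  v k - v j = \sum_(i in inc j) c i *: (v (nbr j i) - v j).
Proof.
pose c i := (b i - dot (a i) (v k)) / (b i - dot (a i) (v (nbr j i))).
have den i : i \in inc j -> 0 < b i - dot (a i) (v (nbr j i)).
  move=> ij; rewrite subr_gt0 lt_neqAle v_le andbT v_eq.
  by rewrite (nbr_inc ij ij) eqxx.
exists c => [i ij|].
  split; first by rewrite divr_ge0 ?subr_ge0 ?v_le.
  by rewrite mulf_eq0 invr_eq0 (gt_eqF (den i ij)) orbF subr_eq0 eq_sym v_eq.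
(* Facet [i] at [v j] contains every neighbour except the one across [i], so pairing with [a i]
   isolates one coefficient. *)
apply/eqP; rewrite -subr_eq0; apply/eqP; apply: (@inc_free j) => i ij.
have bj : dot (a i) (v j) = b i by apply/eqP; rewrite v_eq.
rewrite linearB /= linear_sum (bigD1 i) //= big1 ?addr0 => [|l /andP[lj li]].
  rewrite scalarZ !linearB /= bj /c; have /lt0r_neq0 := den i ij.
  by move: (dot _ (v (nbr j i))) (dot _ (v k)) => y z yb; field.
rewrite scalarZ linearB /= bj; suff /eqP -> : dot (a i) (v (nbr j l)) == b i.
  by rewrite subrr mulr0.
by rewrite v_eq (nbr_inc lj ij) eq_sym.
Qed.

(** Take a vertex [v j] of the face and let [S] be the facets [i] at [v j] with [nbr j i] off the
    face. By [edge_cone] a vertex lies in the face iff it lies on all facets of [S];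
    [conv_hull_face] extends this to all points. *)
Let face_faceof F : face Q F -> F !=set0 ->
  exists (S : {set 'I_m}) j, [/\ S \subset inc j & F = face_of S].
Proof.
move=> [f [be [Qf ->]]] [x [Qx /= fx]].
have sf y : y \in s -> f y <= be by move=> /conv_hull_mem/Qf.
have [j fj] : exists j, f (v j) = be.
  have [p [y ys py] /(_ f be sf)[/(_ fx) h _]] := conv_hull_face Qx.
  by have /vP[j yj] := ys; exists j; rewrite -yj; apply: h.
pose S := [set i in inc j | f (v (nbr j i)) != be]%SET.
exists S, j; split; first by apply/fintype.subsetP=> i; rewrite inE => /andP[].
have vk k : f (v k) = be <-> S \subset inc k.
  have [c cP E] := edge_cone j k.
  have {E} fk : be - f (v k) = \sum_(i in inc j) c i * (be - f (v (nbr j i))).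
    rewrite -[LHS]opprB -{1}fj -linearB E linear_sum -sumrN; apply: eq_bigr => i _.
    by rewrite scalarZ linearB /= fj -mulrN opprB.
  have ge0 i : i \in inc j -> 0 <= c i * (be - f (v (nbr j i))).
    by move=> ij; rewrite mulr_ge0 ?(cP i ij).1 // subr_ge0 Qf.
  split=> [fkb|/fintype.subsetP Sk].
    apply/fintype.subsetP=> i; rewrite inE => /andP[ij fi].
    have /psumr_eq0P/(_ i ij) : \sum_(i in inc j) c i * (be - f (v (nbr j i))) = 0.
      by rewrite -fk fkb subrr.
    move=> /(_ ge0)/eqP; rewrite mulf_eq0 (cP i ij).2 subr_eq0 eq_sym (negPf fi).
    by rewrite orbF.
  apply/esym/eqP; rewrite -subr_eq0 fk big1 // => i ij.
  have [->|fi] := eqVneq (f (v (nbr j i))) be; first by rewrite subrr mulr0.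
  have /eqP-> : c i == 0 by rewrite (cP i ij).2 Sk // inE ij.
  by rewrite mul0r.
apply/seteqP; split=> y [Qy h]; split=> //=.
  have [p _ pP] := conv_hull_face Qy.
  move=> i iS; apply/(pP (dot (a i)) (b i) (s_le i)) => z zs pz.
  have fz : f z = be by apply: (iffLR (pP f be sf)) pz.
  have /vP[k zk] := zs; rewrite zk in fz *; apply/eqP; rewrite v_eq.
  by move/vk: fz => /fintype.subsetP; apply.
have [p _ pP] := conv_hull_face Qy.
apply/(pP f be sf) => z zs pz; have /vP[k zk] := zs; rewrite zk; apply/vk/fintype.subsetP=> i iS.
by rewrite -v_eq -zk; apply/eqP; apply: (iffLR (pP (dot (a i)) (b i) (s_le i))) pz => //; apply: h.
Qed.

Lemma simple_polytope_faces :
  poset_iso (nonempty_faces Q) (fun F G => F `<=` G)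
    [set S : {set 'I_m} | exists j, S \subset inc j] (fun S T => T \subset S).
Proof.
pose lab (F : set 'rV[R]_d) : {set 'I_m} :=
  [set i | `[< F `<=` [set x | dot (a i) x = b i] >]]%SET.
have labP F i : reflect (F `<=` [set x | dot (a i) x = b i]) (i \in lab F).
  by rewrite inE; apply: asboolP.
(* A facet [i] outside [S] misses a vertex of the face: [v j] itself, or the neighbour of [v j]
   across [i]. *)
have lab_face (S : {set 'I_m}) j : S \subset inc j -> lab (face_of S) = S.
  move=> Sj; apply/setP=> i; apply/labP/idP => [h|iS x [_]]; last exact.
  apply/negPn/negP=> iS.
  have ij : i \in inc j by rewrite -v_eq; apply/eqP; apply: h; apply/face_of_v.
  have : i \in inc (nbr j i).
    rewrite -v_eq; apply/eqP; apply: h; apply/face_of_v/fintype.subsetP=> k kS.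
    by rewrite (nbr_inc ij (fintype.subsetP Sj k kS)); apply: contraNneq iS => <-.
  by rewrite (nbr_inc ij ij) eqxx.
have labK F : nonempty_faces Q F -> F = face_of (lab F) /\ exists j, lab F \subset inc j.
  by move=> [fF F0]; have [S [j [Sj ->]]] := face_faceof fF F0;
    rewrite (lab_face S j) //; split=> //; exists j.
exists lab; split.
  split.
  - by move=> F /labK[].
  - by move=> F G; rewrite !inE => /labK[FE _] /labK[GE _] E; rewrite FE GE E.
  - move=> S [j Sj]; exists (face_of S); last exact: lab_face Sj.
    by split; [exact: face_of_face|exists (v j); apply/face_of_v].
move=> F G /labK[FE _] /labK[GE _]; split=> [FG|/fintype.subsetP h].
  by apply/fintype.subsetP=> i /labP Gi; apply/labP; apply: subset_trans FG Gi.
by rewrite FE GE => x [Qx hx]; split=> // i /h; apply: hx.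
Qed.

End SimplePolytope.

(* Restores the names that classical_sets shadows. *)
From mathcomp Require Import fintype finset.

(** * The octagonal prism *)

Section ComplexIso.
Variables (I J : finType) (D : set {set I}) (D' : set {set J}).
Hypothesis D'_closed : forall S T : {set J}, S \subset T -> D' T -> D' S.
Hypothesis D1 : forall i, D [set i]%SET.
Hypothesis D0 : D finset.set0.

(** An order isomorphism preserves the empty simplex, hence singletons, and a simplex is determined
    by the singletons inside it; so the isomorphism is induced by a map [t] of vertices. *)
Lemma complex_iso :
  poset_iso D (fun S T => T \subset S) D' (fun S T => T \subset S) ->
  exists t : I -> J, [/\ injective t, forall S : {set I}, D S <-> D' (t @: S)%SET &
    forall y, D' [set y]%SET -> exists x, y = t x].
Proof.
move=> [h [[hD h_inj h_surj] h_le]].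
have hI S T : D S -> D T -> h S = h T -> S = T by move=> DS DT; apply: h_inj; apply/mem_set.
have h0 : h finset.set0 = finset.set0.
  have [S DS hS] := h_surj finset.set0 (D'_closed (finset.sub0set _) (hD _ D0)).
  by apply/eqP; rewrite -finset.subset0 -hS; apply/(h_le _ _ DS D0); apply: finset.sub0set.
have D'1 S y : D S -> y \in h S -> D' [set y]%SET.
  by move=> DS yS; apply: D'_closed (hD S DS); rewrite sub1set.
have h1 i : exists y, h [set i]%SET = [set y]%SET.
  have /set0Pn[y yi] : h [set i]%SET != finset.set0.
    rewrite -h0; apply/eqP=> /(hI _ _ (D1 i) D0)/setP/(_ i).
    by rewrite !inE eqxx.
  have [S DS hS] := h_surj _ (D'1 _ _ (D1 i) yi).
  exists y; rewrite -hS; congr h; apply/eqP; rewrite eq_sym.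
  have : S \subset [set i]%SET by apply/(h_le _ _ (D1 i) DS); rewrite hS sub1set.
  rewrite subset1 => /orP[//|/eqP S0].
  by move: hS; rewrite S0 h0 => /setP/(_ y); rewrite !inE eqxx.
have /choice[t tE] := h1.
have t_inj : injective t.
  move=> i j tij; have /(hI _ _ (D1 i) (D1 j))/setP/(_ i) : h [set i]%SET = h [set j]%SET.
    by rewrite !tE tij.
  by rewrite !inE eqxx => /esym/eqP.
have hE S : D S -> h S = (t @: S)%SET.
  move=> DS; apply/setP=> y; apply/idP/imsetP => [yS|[i iS ->]].
    have [T DT hT] := h_surj _ (D'1 _ _ DS yS).
    have TS : T \subset S by apply/(h_le _ _ DS DT); rewrite hT sub1set.
    have /set0Pn[i iT] : T != finset.set0.
      by apply/eqP=> T0; move: hT; rewrite T0 h0 => /setP/(_ y); rewrite !inE eqxx.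
    exists i; first exact: (fintype.subsetP TS).
    have : h [set i]%SET \subset h T by apply/(h_le _ _ DT (D1 i)); rewrite sub1set.
    by rewrite hT tE sub1set inE => /eqP.
  by rewrite -sub1set -tE; apply/(h_le _ _ DS (D1 i)); rewrite sub1set.
exists t; split=> // [S|y D'y].
  split=> [DS|D'S]; first by rewrite -hE //; apply: hD.
  have [T DT] := h_surj _ D'S; rewrite hE // => /(imset_inj t_inj) <- //.
have [S DS hS] := h_surj _ D'y.
have /set0Pn[i iS] : S != finset.set0.
  by apply/eqP=> S0; move: hS; rewrite S0 h0 => /setP/(_ y); rewrite !inE eqxx.
exists i; have : t i \in h S by rewrite hE // imset_f.
by rewrite hS inE => /eqP.
Qed.

End ComplexIso.

(** Corner [j] lies on the sides [j] and [j + 1] modulo 8 of the octagon cut out by [facet_normal]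
    and [facet_bound]; all data are integers so that incidences compute. *)
Definition octagon : seq (int * int) :=
  [:: (2, 1); (1, 2); (-1, 2); (-2, 1); (-2, -1); (-1, -2); (1, -2); (2, -1)].

Definition vertex_coord (j : nat) : seq int :=
  [:: (nth (0, 0) octagon (j %% 8)).1; (nth (0, 0) octagon (j %% 8)).2;
      if (j < 8)%N then -1 else 1].

Definition facet_normal (i : nat) : seq int :=
  nth [::] [:: [:: 1; 0; 0]; [:: 1; 1; 0]; [:: 0; 1; 0]; [:: -1; 1; 0]; [:: -1; 0; 0];
    [:: -1; -1; 0]; [:: 0; -1; 0]; [:: 1; -1; 0]; [:: 0; 0; -1]; [:: 0; 0; 1]] i.

Definition facet_bound (i : nat) : int := nth 0 [:: 2; 3; 2; 3; 2; 3; 2; 3; 1; 1] i.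

(* The end of the edge at vertex [j] that leaves facet [i]. *)
Definition neighbour (j i : nat) : nat :=
  if (8 <= i)%N then ((j + 8) %% 16)%N
  else (8 * (j %/ 8) + (if i == j %% 8 then j + 1 else j + 7) %% 8)%N.

Definition int_dot (i j : nat) : int :=
  (vertex_coord j)`_0 * (facet_normal i)`_0 + (vertex_coord j)`_1 * (facet_normal i)`_1
  + (vertex_coord j)`_2 * (facet_normal i)`_2.

Lemma in_facet_set j i : (i \in facet_set j) = ((i : nat) \in facets_at j).
Proof. by rewrite inE. Qed.

Section Prism.
Variable R : realType.

Definition prism_vertex (j : 'I_16) : 'rV[R]_3 := \row_(k < 3) ((vertex_coord j)`_k)%:~R.
Definition prism_normal (i : 'I_10) : 'cV[R]_3 := \col_(k < 3) ((facet_normal i)`_k)%:~R.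
Definition prism_bound (i : 'I_10) : R := (facet_bound i)%:~R.

Lemma dot_normal i (x : 'rV[R]_3) : dot (prism_normal i) x =
  x 0 0 * ((facet_normal i)`_0)%:~R + x 0 1 * ((facet_normal i)`_1)%:~R +
  x 0 2%:R * ((facet_normal i)`_2)%:~R.
Proof.
rewrite /dot mxE !big_ord_recl big_ord0 !mxE addr0 addrA /=.
by congr (_ * _ + _ * _ + _ * _); congr (x _ _); apply: val_inj.
Qed.

Lemma dot_vertex i j : dot (prism_normal i) (prism_vertex j) = (int_dot i j)%:~R.
Proof. by rewrite dot_normal !mxE /int_dot !intrD !intrM. Qed.

Lemma prism_le j i : dot (prism_normal i) (prism_vertex j) <= prism_bound i.
Proof.
rewrite dot_vertex ler_int.
by apply: (@all_iota2P 16 10 (fun j i => int_dot i j <= facet_bound i)); vm_compute.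
Qed.

Lemma prism_eq j i :
  (dot (prism_normal i) (prism_vertex j) == prism_bound i) = (i \in facet_set j).
Proof.
rewrite dot_vertex eqr_int in_facet_set; apply: eqP.
by apply: (@all_iota2P 16 10 (fun j i => (int_dot i j == facet_bound i) == (i \in facets_at j)));
  vm_compute.
Qed.

Lemma prism_neighbour j i k : i \in facet_set j -> k \in facet_set j ->
  (k \in facet_set (inord (neighbour j i))) = (k != i).
Proof.
rewrite !in_facet_set => ij kj; rewrite inordK; last first.
  by apply: (@all_iota2P 16 10 (fun j i => neighbour j i < 16)%N); vm_compute.
have : all (fun j => all (fun i => all (fun k => (i \in facets_at j) ==> (k \in facets_at j) ==>
  ((k \in facets_at (neighbour j i)) == (k != i))) (iota 0 10)) (iota 0 10)) (iota 0 16).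
  by vm_compute.
move=> /(@all_iota2P 16 10 (fun j i => _))/(_ j i)/(@all_iotaP 10 (fun k => _))/(_ k).
by rewrite ij kj => /eqP.
Qed.

Lemma prism_free j x : (forall i, i \in facet_set j -> dot (prism_normal i) x = 0) -> x = 0.
Proof.
move=> h; have hn (i : nat) (ij : i \in facets_at j) (i10 : (i < 10)%N) :
    x 0 0 * ((facet_normal i)`_0)%:~R + x 0 1 * ((facet_normal i)`_1)%:~R +
      x 0 2%:R * ((facet_normal i)`_2)%:~R = 0.
  by rewrite -(dot_normal (Ordinal i10)); apply: h; rewrite in_facet_set.
(* The two octagon normals at a corner have determinant 1. *)
pose k := (j %% 8)%N; pose l := ((j + 1) %% 8)%N; pose c := (8 + j %/ 8)%N.
pose N i e : int := (facet_normal i)`_e.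
have : [&& (k < 10)%N, (l < 10)%N, (c < 10)%N, N k 2 == 0, N l 2 == 0, N c 0 == 0, N c 1 == 0,
    N c 2 * N c 2 == 1 & N k 0 * N l 1 - N k 1 * N l 0 == 1].
  apply: (@all_iotaP 16 (fun j => let k := (j %% 8)%N in let l := ((j + 1) %% 8)%N in
    let c := (8 + j %/ 8)%N in [&& (k < 10)%N, (l < 10)%N, (c < 10)%N,
    N k 2 == 0, N l 2 == 0, N c 0 == 0, N c 1 == 0, N c 2 * N c 2 == 1 &
    N k 0 * N l 1 - N k 1 * N l 0 == 1])).
  by vm_compute.
move=> /andP[k10 /andP[l10 /andP[c10 /andP[/eqP k2 /andP[/eqP l2]]]]].
move=> /andP[/eqP c0 /andP[/eqP c1 /andP[/eqP cc /eqP det]]].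
have kj : k \in facets_at j by rewrite !inE eqxx.
have lj : l \in facets_at j by rewrite !inE eqxx orbT.
have cj : c \in facets_at j by rewrite !inE eqxx !orbT.
move: (hn k kj k10) (hn l lj l10) (hn c cj c10).
rewrite -!/(N _ _) k2 l2 c0 c1 !mulr0 !addr0 !add0r => ek el ec.
have {}det : (N k 0)%:~R * (N l 1)%:~R - (N k 1)%:~R * (N l 0)%:~R = 1 :> R.
  by rewrite -!intrM -intrB det.
have {}cc : (N c 2)%:~R * (N c 2)%:~R = 1 :> R by rewrite -intrM cc.
have x0 : x 0 0 = 0.
  transitivity ((N l 1)%:~R * (x 0 0 * (N k 0)%:~R + x 0 1 * (N k 1)%:~R)
    - (N k 1)%:~R * (x 0 0 * (N l 0)%:~R + x 0 1 * (N l 1)%:~R)); last by rewrite ek el; ring.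
  by rewrite -[LHS]mulr1 -[X in _ * X = _]det; ring.
have x1 : x 0 1 = 0.
  transitivity ((N k 0)%:~R * (x 0 0 * (N l 0)%:~R + x 0 1 * (N l 1)%:~R)
    - (N l 0)%:~R * (x 0 0 * (N k 0)%:~R + x 0 1 * (N k 1)%:~R)); last by rewrite ek el; ring.
  by rewrite -[LHS]mulr1 -[X in _ * X = _]det; ring.
have x2 : x 0 2%:R = 0 by rewrite -[LHS]mulr1 -[X in _ * X]cc mulrA ec mul0r.
apply/rowP=> -[[|[|[|//]]] e3]; rewrite mxE.
- by rewrite -x0; congr (x _ _); apply: val_inj.
- by rewrite -x1; congr (x _ _); apply: val_inj.
- by rewrite -x2; congr (x _ _); apply: val_inj.
Qed.

Definition prism : set 'rV[R]_3 := conv_hull (vertices prism_vertex).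

Lemma prism_faces :
  poset_iso (nonempty_faces prism) (fun F G => F `<=` G)%classic
    [set S : {set 'I_10} | exists j, S \subset facet_set j]%classic (fun S T => T \subset S).
Proof.
exact: (simple_polytope_faces prism_le prism_eq prism_neighbour prism_free).
Qed.

Lemma P7_complex :
  poset_iso [set S : {set 'I_10} | exists j, S \subset facet_set j]%classic
    (fun S T => T \subset S)
    [set T : {set {set P7_poset}} | tubing T]%classic (fun S T => T \subset S).
Proof.
exists (fun S : {set 'I_10} => tube_of @: S)%SET; split; first split.
- by move=> S [j Sj]; apply/P7_tubing; exists S => //; exists j.
- by move=> S T _ _; apply: (imset_inj tube_of_inj).
- by move=> T /P7_tubing[S -> Sj]; exists S.
move=> S T _ _; split=> [TS|/fintype.subsetP h]; first exact: imsetS.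
apply/fintype.subsetP=> i iT; have := h _ (imset_f tube_of iT).
by rewrite (mem_imset _ _ tube_of_inj).
Qed.

Lemma prism_associahedron : poset_associahedron P7_poset prism.
Proof.
split; first by exists (vertices prism_vertex).
exact: poset_iso_trans prism_faces P7_complex.
Qed.

End Prism.

Lemma card_facet_set j : (#|facet_set j| <= 3)%N.
Proof.
rewrite cardE -(size_map val) (leq_trans (uniq_leq_size (s2 := facets_at j) _ _)) //.
  by rewrite (map_inj_uniq val_inj) enum_uniq.
by move=> i /mapP[k]; rewrite mem_enum in_facet_set => ? ->.
Qed.

Lemma height_two_no_chain (disp : Order.disp_t) (P : finPOrderType disp) :
  (forall C : {set P}, chain C -> (#|C| <= 2)%N) ->
  forall x y z : P, (x < y)%O -> (y < z)%O -> False.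
Proof.
move=> h x y z xy yz; have xz := lt_trans xy yz.
have := h [set x; y; z]%SET; rewrite -setUA cardsU1 cards2 !inE.
rewrite (lt_eqF xy) (lt_eqF xz) (lt_eqF yz) /= => /(_ _)/negP; apply=> //.
move=> a c; rewrite !inE.
case/or3P=> /eqP-> /or3P[] /eqP->; rewrite ?comparablexx // /Order.comparable
  ?(ltW xy) ?(ltW yz) ?(ltW xz) ?orbT //.
Qed.

(** * Exclusion of posets of height two *)

Section NotHeightTwo.
Context {disp : Order.disp_t} {P : finPOrderType disp}.
Hypothesis ht2 : forall x y z : P, (x < y)%O -> (y < z)%O -> False.

(** [complex_iso] labels the proper tubes of [P] by the ten facets, and the hypotheses of
    [suspended_octagon_false] are then read off from [facets_at]. *)
Lemma height_two_not_prism :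
  ~ poset_iso [set S : {set 'I_10} | exists j, S \subset facet_set j]%classic
      (fun S T => T \subset S)
      [set T : {set {set P}} | tubing T]%classic (fun S T => T \subset S).
Proof.
move=> prism_iso; have [|||t [t_inj tE t_surj]] := complex_iso _ _ _ prism_iso.
- by move=> S T; apply: tubingS.
- move=> i; have : has (fun j => (i : nat) \in facets_at j) (iota 0 16).
    by apply: (@all_iotaP 10 (fun i => has (fun j => i \in facets_at j) (iota 0 16))); vm_compute.
  move=> /hasP[j]; rewrite mem_iota add0n => /andP[_ j16] ij.
  by exists (Ordinal j16); rewrite sub1set in_facet_set.
- by exists ord0; apply: finset.sub0set.
have {}tE (S : {set 'I_10}) : (exists j, S \subset facet_set j) <-> tubing (t @: S)%SET := tE S.
pose w (k : 'I_8) : 'I_10 := widen_ord (isT : 8 <= 10)%N k.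
pose u : 'I_10 := Ordinal (isT : 8 < 10)%N.
pose u' : 'I_10 := Ordinal (isT : 9 < 10)%N.
have t2 i k : tubing [set t i; t k]%SET <-> exists j, (i \in facet_set j) && (k \in facet_set j).
  have -> : [set t i; t k]%SET = (t @: [set i; k])%SET by rewrite imsetU !imset_set1.
  rewrite -(tE [set i; k]%SET).
  by split=> -[j h]; exists j; move: h; rewrite subUset !sub1set.
have surj A : tube A -> A != [set: P]%SET -> exists i, A = t i.
  by move=> tA AT; apply: t_surj; rewrite /= tubing1 tA AT.
apply: (@suspended_octagon_false _ P ht2 (t u) (t u') (fun k => t (w k))).
- by move=> k l /t_inj kl; apply: val_inj; exact: (congr1 val kl).
- by move=> k; rewrite (inj_eq t_inj) -val_eqE /= ltn_eqF.
- by move=> k; rewrite (inj_eq t_inj) -val_eqE /= ltn_eqF // ltnW // ltnS.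
- move=> A tA AT; have [i ->] := surj A tA AT.
  case: (ltnP i 8) => [i8|]; first by constructor 3; exists (Ordinal i8); congr t; apply: val_inj.
  rewrite leq_eqVlt => /orP[/eqP i8|i9].
    by constructor 1; congr t; apply: val_inj.
  constructor 2; congr t; apply/val_inj/eqP; rewrite eqn_leq i9 andbT -ltnS.
  exact: ltn_ord.
(* Vertex [k] lies on side [k] and cap 8, and vertex [k + 8], used next, on side [k] and cap 9. *)
- move=> k; apply/t2; have k16 : (k < 16)%N by rewrite (ltn_trans (ltn_ord k)).
  exists (Ordinal k16); rewrite !in_facet_set !inE /= modn_small // divn_small // eqxx.
  by rewrite ?orbT.
- move=> k; apply/t2; have k16 : (k + 8 < 16)%N by rewrite -[16%N]/(8 + 8)%N ltn_add2r.
  exists (Ordinal k16); rewrite !in_facet_set !inE /= modnDr modn_small // divnDr // divn_small // eqxx.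
  by rewrite ?orbT.
- apply/negP=> /t2[j]; rewrite !in_facet_set; apply/negP.
  by apply: (@all_iotaP 16 (fun j => ~~ ((8 \in facets_at j) && (9 \in facets_at j)))%N); vm_compute.
- move=> k l /t2[j]; rewrite !in_facet_set; apply/implyP.
  have : all (fun j => all (fun k => all (fun l => (k \in facets_at j) && (l \in facets_at j) ==>
    side_adj k l) (iota 0 8)) (iota 0 8)) (iota 0 16) by vm_compute.
  by move=> /(@all_iota2P 16 8 (fun j i => _))/(_ j k)/(@all_iotaP 8 (fun k => _))/(_ l).
(* All tubes of [T] are values of [t], so [T] is the image of its preimage, which lies in some
   [facet_set j]. *)
- move=> T tT; have ET : T = (t @: (t @^-1: T))%SET.
    apply/setP=> A; apply/idP/imsetP => [AT|[i]]; last by rewrite inE => ? ->.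
    have /tubingP[/(_ _ AT)[tA A1] _ _] := tT.
    by have [i Ai] := surj A tA A1; exists i; rewrite // inE -Ai.
  have /tE[j Tj] : tubing (t @: (t @^-1: T))%SET by rewrite -ET.
  rewrite ET (card_imset _ t_inj); exact: leq_trans (subset_leq_card Tj) (card_facet_set j).
Qed.

End NotHeightTwo.

Theorem theorem4p3 (R : realType) :
  exists (disp : Order.disp_t) (P : finPOrderType disp)
         (d : nat) (Q : set 'rV[R]_d),
    poset_associahedron P Q /\
    ~ (exists (disp' : Order.disp_t) (P' : finPOrderType disp')
              (d' : nat) (Q' : set 'rV[R]_d'),
         [/\ (forall C : {set P'}, chain C -> (#|C| <= 2)%N),
             poset_associahedron P' Q'
           & comb_equiv Q' Q]).
Proof.
exists P7_display, P7_poset, 3, (@prism R); split; first exact: prism_associahedron.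
move=> [disp' [P' [d' [Q' [/height_two_no_chain ht2 [_ Q'_iso] Q'Q]]]]].
apply: (height_two_not_prism ht2).
(* Any set of points can serve as the default value that [poset_iso_sym] asks for. *)
apply: poset_iso_trans Q'_iso; apply: poset_iso_sym; first exact: (@classical_sets.set0 _).
exact: poset_iso_trans Q'Q (@prism_faces R).
Qed.
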